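(* For non-zero integers $a,b,c$ let $\rho(B;a,b,c)$ be the number of integer triples $(x,y,z)$ with $ax^3+by^3+cz^3=0$, $\gcd(x,y,z)=1$ and $\max(|x|,|y|,|z|)\le B$. Then for any $\varepsilon>0$, \[\rho(B;a,b,c)\ll_\varepsilon B^\varepsilon,\] uniformly for all non-zero integers $a,b,c$ (the implied constant depends only on $\varepsilon$). *)

(* Defs.v *)
From Stdlib Require Import Reals.
From mathcomp Require Import all_boot all_order all_algebra.
Set Implicit Arguments. Unset Strict Implicit. Unset Printing Implicit Defensive.
Import Order.TTheory GRing.Theory Num.Theory.
Local Open Scope ring_scope.

Definition box (B : nat) : seq int :=
  [seq ((k%:Z) - (B%:Z))%R | k <- iota 0 (2 * B).+1].

Definition good (B : nat) (a b c : int) (t : int * int * int) : bool :=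
  let: (x, y, z) := t in
  [&& a * x ^+ 3 + b * y ^+ 3 + c * z ^+ 3 == 0,
      gcdz (gcdz x y) z == 1%N,
      (`|x| <= B%:Z), (`|y| <= B%:Z) & (`|z| <= B%:Z)].

(* rho(B; a, b, c): number of such integer triples (each triple counted once,
   since box B has no duplicates). *)
Definition rho (B : nat) (a b c : int) : nat :=
  count (good B a b c)
    [seq (xy, z) | xy <- [seq (x, y) | x <- box B, y <- box B], z <- box B].

(* Main.v *)
(** Heights and a 3-isogeny descent, made elementary.  For two points P, Q of
    a x^3 + b y^3 + c z^3 = 0 put p = (y Z, z X, x Y), q = (z Y, x Z, y X) and
    U_j = prod_i (p_i - om^j q_i) for j = 0, 1, 2, where om is a primitive cube root
    of unity.  Then U_0 + U_1 + U_2 = 0 and U_0 U_1 U_2 is abc times a cube: up to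
    scaling, (U_0, U_1, U_2) describes the point P - Q of the Jacobian.
    Dividing by the gcd in Z[om], the U_j become pairwise coprime, so
    U_j = c_j w_j^3 with c_j dividing the cube-free part d of abc; there are only
    d^(o(1)) classes (c_0, c_1, c_2).  Fix a base point O and two points P, Q with
    (P, O), (Q, O) in the same class; the corresponding w, x lie on
    c_0 X^3 + c_1 Y^3 + c_2 Z^3 = 0, and P - Q is the image of w - x under the
    isogeny sqrt(-3).  Explicitly, S(w,x)^3 U_1(P,Q) = - S(x,w)^3 U_2(P,Q),
    where the U_j(w,x) are linear in S(w,x) and S(x,w).  Hence the height of
    w - x is essentially the cube root of that of P - Q, which is at most a power
    of B since P and Q have size at most B.  After k steps all differences have
    height O(B^(12/3^k)), so a bounded power of this bounds the number of points
    of a final class; and d is at most a power of B as soon as two points exist. *)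

Require Import Defs.
From Stdlib Require Import Reals.
From mathcomp Require Import all_boot all_order all_algebra.
From HB Require Import structures.
From Stdlib Require Import Classical Lra.
From mathcomp Require Import ring zify.
Set Implicit Arguments. Unset Strict Implicit. Unset Printing Implicit Defensive.
Import Order.TTheory GRing.Theory Num.Theory.
Local Open Scope ring_scope.

(** * Eisenstein integers *)

(** [Eis a b] is a + b om, where om^2 + om + 1 = 0. *)
Record eis := Eis { ere : int; eim : int }.

Definition pair_of_eis (x : eis) := (ere x, eim x).
Definition eis_of_pair (p : int * int) := Eis p.1 p.2.
Lemma pair_of_eisK : cancel pair_of_eis eis_of_pair. Proof. by case. Qed.
HB.instance Definition _ := Countable.copy eis (can_type pair_of_eisK).

Lemma eis_ext (x y : eis) : ere x = ere y -> eim x = eim y -> x = y.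
Proof. by case: x y => a b [c d] /= -> ->. Qed.

Definition eis_add (x y : eis) := Eis (ere x + ere y) (eim x + eim y).
Definition eis_opp (x : eis) := Eis (- ere x) (- eim x).
Definition eis_mul (x y : eis) :=
  Eis (ere x * ere y - eim x * eim y) (ere x * eim y + eim x * ere y - eim x * eim y).

Lemma eis_addA : associative eis_add.
Proof. by move=> x y z; apply: eis_ext => /=; ring. Qed.
Lemma eis_addC : commutative eis_add.
Proof. by move=> x y; apply: eis_ext => /=; ring. Qed.
Lemma eis_add0 : left_id (Eis 0 0) eis_add.
Proof. by move=> x; apply: eis_ext => /=; ring. Qed.
Lemma eis_addN : left_inverse (Eis 0 0) eis_opp eis_add.
Proof. by move=> x; apply: eis_ext => /=; ring. Qed.
HB.instance Definition _ :=
  GRing.isZmodule.Build eis eis_addA eis_addC eis_add0 eis_addN.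

Lemma eis_mulA : associative eis_mul.
Proof. by move=> x y z; apply: eis_ext => /=; ring. Qed.
Lemma eis_mulC : commutative eis_mul.
Proof. by move=> x y; apply: eis_ext => /=; ring. Qed.
Lemma eis_mul1 : left_id (Eis 1 0) eis_mul.
Proof. by move=> x; apply: eis_ext => /=; ring. Qed.
Lemma eis_mulD : left_distributive eis_mul +%R.
Proof. by move=> x y z; apply: eis_ext => /=; ring. Qed.
Lemma eis_one_neq0 : Eis 1 0 != 0. Proof. by []. Qed.
HB.instance Definition _ := GRing.Zmodule_isComNzRing.Build eis
  eis_mulA eis_mulC eis_mul1 eis_mulD eis_one_neq0.

Definition normz (x : eis) : int := ere x ^+ 2 - ere x * eim x + eim x ^+ 2.
Definition econj (x : eis) := Eis (ere x - eim x) (- eim x).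

Lemma ere0 : ere 0 = 0. Proof. by []. Qed.
Lemma eim0 : eim 0 = 0. Proof. by []. Qed.
Lemma ere1 : ere 1 = 1. Proof. by []. Qed.
Lemma eim1 : eim 1 = 0. Proof. by []. Qed.
Lemma ereD x y : ere (x + y) = ere x + ere y. Proof. by []. Qed.
Lemma eimD x y : eim (x + y) = eim x + eim y. Proof. by []. Qed.
Lemma ereN x : ere (- x) = - ere x. Proof. by []. Qed.
Lemma eimN x : eim (- x) = - eim x. Proof. by []. Qed.
Lemma ereM x y : ere (x * y) = ere x * ere y - eim x * eim y. Proof. by []. Qed.
Lemma eimM x y : eim (x * y) = ere x * eim y + eim x * ere y - eim x * eim y.
Proof. by []. Qed.
Definition eisE := (ere0, eim0, ere1, eim1, ereD, eimD, ereN, eimN, ereM, eimM).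

Lemma normzM x y : normz (x * y) = normz x * normz y.
Proof. by rewrite /normz !eisE; ring. Qed.
Lemma normz_ge0 x : 0 <= normz x.
Proof. by rewrite /normz !expr2; nia. Qed.
Lemma normz_eq0 x : (normz x == 0) = (x == 0).
Proof.
apply/eqP/eqP => [|->]; last by rewrite /normz.
rewrite /normz !expr2 => H; apply: eis_ext; rewrite !eisE; nia.
Qed.
Lemma normz1 : normz 1 = 1. Proof. by []. Qed.
Lemma mul_econj x : x * econj x = Eis (normz x) 0.
Proof. by apply: eis_ext; rewrite /normz !eisE /=; ring. Qed.

Definition eis_unit (x : eis) := normz x == 1.
Definition eis_inv (x : eis) := if eis_unit x then econj x else x.
Lemma eis_mulVr : {in eis_unit, left_inverse 1 eis_inv *%R}.
Proof.
move=> x ux; rewrite /eis_inv (ux : eis_unit x) mulrC mul_econj.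
by rewrite (eqP (ux : eis_unit x)).
Qed.
Lemma eis_unitP x y : y * x = 1 -> eis_unit x.
Proof.
move=> /(congr1 normz); rewrite normzM normz1 /eis_unit => H.
have := normz_ge0 x; have := normz_ge0 y; move: (normz x) (normz y) H => a b H b0 a0.
have [|a1] := leP a 1; last by have [|b1] := leP b 0; nia.
move=> a1; apply/eqP; have [a2|a2] := leP 1 a; first lia.
have a3 : a = 0 by lia.
by move: H; rewrite a3; lia.
Qed.
Lemma eis_inv0 : {in [predC eis_unit], eis_inv =1 id}.
Proof. by move=> x ux; rewrite /eis_inv ifN //; exact: ux. Qed.
HB.instance Definition _ := GRing.ComNzRing_hasMulInverse.Build eis
  eis_mulVr eis_unitP eis_inv0.
Lemma eis_idomain (x y : eis) : x * y = 0 -> (x == 0) || (y == 0).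
Proof. by move=> /eqP; rewrite -!normz_eq0 normzM mulf_eq0. Qed.
HB.instance Definition _ := GRing.ComUnitRing_isIntegral.Build eis eis_idomain.

Definition norm (x : eis) : nat := `|normz x|%N.

Lemma normE x : (norm x)%:Z = normz x.
Proof. by rewrite /norm gez0_abs // normz_ge0. Qed.
Lemma normM x y : norm (x * y) = (norm x * norm y)%N.
Proof. by rewrite /norm normzM abszM. Qed.
Lemma norm_eq0 x : (norm x == 0%N) = (x == 0).
Proof. by rewrite /norm absz_eq0 normz_eq0. Qed.
Lemma norm_gt0 x : (0 < norm x)%N = (x != 0).
Proof. by rewrite lt0n norm_eq0. Qed.
Lemma normX x n : norm (x ^+ n) = (norm x ^ n)%N.
Proof. by elim: n => // n IH; rewrite exprS normM IH expnS. Qed.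
Lemma norm_leD x y : (norm (x + y)%R <= 2 * (norm x + norm y))%N.
Proof.
suff : normz (x + y) <= 2 * (normz x + normz y) by rewrite -!normE; lia.
have := normz_ge0 (x - y); rewrite /normz !eisE => H.
by rewrite -subr_ge0; apply: le_trans H _; rewrite le_eqVlt; apply/orP; left; apply/eqP; ring.
Qed.
Lemma normN x : norm (- x) = norm x.
Proof. by rewrite /norm /normz !eisE; congr absz; ring. Qed.

(** Rounding both coordinates of x/y = x conj(y)/D, with D the norm of y, leaves an error with
    coordinates at most 1/2 in absolute value, hence of norm at most 3/4. *)
Lemma eis_euclid (x y : eis) : y != 0 -> exists q, (norm (x - q * y)%R < norm y)%N.
Proof.
move=> y0; pose t := x * econj y; pose D := normz y.
have D0 : 0 < D by rewrite /D lt_def normz_ge0 normz_eq0 y0.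
(* The integer nearest to m/D. *)
pose rd (m : int) := ((2 * m + D) %/ (2 * D))%Z.
have rdP m : - D <= 2 * (m - rd m * D) <= D.
  have D2 : 2 * D != 0 by lia.
  have := divz_eq (2 * m + D) (2 * D); have := modz_ge0 (2 * m + D) D2.
  have := ltz_pmod (2 * m + D) (_ : 0 < 2 * D); rewrite -/(rd m); nia.
pose q := Eis (rd (ere t)) (rd (eim t)).
exists q.
suff : normz (x - q * y) < D by rewrite -ltz_nat !normE.
have E : (x - q * y) * econj y = Eis (ere t - rd (ere t) * D) (eim t - rd (eim t) * D).
  rewrite mulrBl -mulrA mul_econj -/D -/t /q.
  by apply: eis_ext; rewrite !eisE /=; ring.
have cD : normz (econj y) = D by rewrite /D /normz /=; ring.
have /(congr1 normz) := E; rewrite normzM cD.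
have := normz_ge0 (x - q * y); move: (normz (x - q * y)) => w w0.
have := rdP (ere t); have := rdP (eim t); rewrite /normz /=.
move: (ere t - _) (eim t - _) => u v /andP[v1 v2] /andP[u1 u2] Ew.
rewrite ltNge; apply/negP => Dw.
have : D * D <= w * D by rewrite ler_pM2r.
rewrite Ew !expr2.
have : 4 * (u * u - u * v + v * v) <= 3 * (D * D) by nia.
have : 0 < D * D by rewrite mulr_gt0.
lia.
Qed.

(** * Divisibility and cube-free parts *)

Definition edvd (x y : eis) := exists z, y = z * x.
(** The Bezout form of coprimality, available because Z[om] is Euclidean; Gauss's lemma becomes a
    direct computation. *)
Definition ecoprime (x y : eis) := exists u v, u * x + v * y = 1.

Lemma edvd_refl x : edvd x x. Proof. by exists 1; rewrite mul1r. Qed.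
Lemma edvd_trans y x z : edvd x y -> edvd y z -> edvd x z.
Proof. by move=> [u ->] [v ->]; exists (v * u); rewrite mulrA. Qed.
Lemma edvd_mull x y z : edvd x y -> edvd x (z * y).
Proof. by move=> [u ->]; exists (z * u); rewrite mulrA. Qed.
Lemma edvd_add x y z : edvd x y -> edvd x z -> edvd x (y + z).
Proof. by move=> [u ->] [v ->]; exists (u + v); rewrite mulrDl. Qed.
Lemma edvd_norm x y : y != 0 -> edvd x y -> (norm x <= norm y)%N.
Proof.
move=> y0 [z yE]; move: y0; rewrite yE -norm_gt0 normM muln_gt0 => /andP[z0 _].
exact: leq_pmull.
Qed.
Lemma edvd_neq0 x y : y != 0 -> edvd x y -> x != 0.
Proof. by move=> y0 [z yE]; apply: contraNneq y0 => x0; rewrite yE x0 mulr0. Qed.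

Lemma norm1P x : reflect (edvd x 1) (norm x == 1%N).
Proof.
apply: (iffP eqP) => [n1|[z /esym/(congr1 norm)]].
  exists (econj x); rewrite mulrC mul_econj; apply: eis_ext => //=.
  by rewrite -normE n1.
by rewrite normM (_ : norm 1 = 1%N) // => /eqP; rewrite muln_eq1 => /andP[_ /eqP].
Qed.

Lemma eis_bezout x y : exists g u v, [/\ g = u * x + v * y, edvd g x & edvd g y].
Proof.
have [n] := ubnP (norm y); elim: n x y => // n IH x y lt_y.
have [->|y0] := eqVneq y 0.
  exists x, 1, 0; split; [by ring | exact: edvd_refl | by exists 0; rewrite mul0r].
have [q lt_r] := eis_euclid x y0.
have [g [u [v [gE gy gr]]]] := IH y (x - q * y) (leq_trans lt_r lt_y).
exists g, v, (u - v * q); split=> //; first by rewrite gE; ring.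
have -> : x = (x - q * y) + q * y by ring.
by apply: edvd_add => //; apply: edvd_mull.
Qed.

Lemma reduce_coprime x y : (x != 0) || (y != 0) ->
  exists g x' y', [/\ g != 0, x = g * x', y = g * y' & ecoprime x' y'].
Proof.
move=> xy0; have [g [u [v [gE [x' xE] [y' yE]]]]] := eis_bezout x y.
have g0 : g != 0.
  by apply: contraTneq xy0 => g0; rewrite xE yE g0 !mulr0 eqxx.
exists g, x', y'; split; rewrite // ?xE ?yE 1?mulrC //.
exists u, v; apply: (mulIf g0); rewrite mul1r [RHS]gE xE yE; ring.
Qed.

Lemma ecoprime_sym x y : ecoprime x y -> ecoprime y x.
Proof. by move=> [u [v E]]; exists v, u; rewrite addrC. Qed.
Lemma gauss x y z : ecoprime x y -> edvd x (y * z) -> edvd x z.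
Proof.
move=> [u [v E]] [w Ew]; exists (u * z + v * w).
by rewrite -[z in LHS]mul1r -E mulrDl -[v * y * z]mulrA Ew; ring.
Qed.
Lemma ecoprimeM x y z : ecoprime x y -> ecoprime x z -> ecoprime x (y * z).
Proof.
move=> [u [v E]] [u' [v' E']].
exists (u * u' * x + u * v' * z + v * y * u'), (v * v').
have : (u * x + v * y) * (u' * x + v' * z) = 1 by rewrite E E' mulr1.
by move=> <-; ring.
Qed.
Lemma ecoprimeX x y n : ecoprime x y -> ecoprime x (y ^+ n).
Proof.
move=> c; elim: n => [|n IH]; first by exists 0, 1; ring.
by rewrite exprS; apply: ecoprimeM.
Qed.
Lemma ecoprime_dvd x y x' : edvd x' x -> ecoprime x y -> ecoprime x' y.
Proof. by move=> [z ->] [u [v E]]; exists (u * z), v; rewrite -mulrA. Qed.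

(** Irreducibility combined with Bezout: this dichotomy yields Euclid's lemma and the case split
    used in counting divisors. *)
Definition eprime p := [/\ p != 0, norm p != 1%N & forall y, ecoprime p y \/ edvd p y].

(** A nonunit without nonunit divisors of smaller norm is prime: its gcd with any y is a unit or has
    the same norm, and is then associated to it. *)
Lemma eprime_exists x : x != 0 -> norm x != 1%N -> exists2 p, eprime p & edvd p x.
Proof.
have [n] := ubnP (norm x); elim: n x => // n IH x lt_x x0 x1.
case: (classic (exists z, [/\ edvd z x, norm z != 1%N & (norm z < norm x)%N])).
  move=> [z [zx z1 ltz]]; have [p pp pz] := IH z (leq_trans ltz lt_x) (edvd_neq0 x0 zx) z1.
  by exists p => //; apply: edvd_trans zx.
move=> irr; exists x; last exact: edvd_refl.
split=> // y; have [g [u [v [gE gx gy]]]] := eis_bezout x y.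
have [/norm1P [w w1]|g1] := boolP (norm g == 1%N).
  by left; exists (w * u), (w * v); rewrite w1 gE; ring.
right; apply: edvd_trans gy.
have [z xE] := gx.
have g0 : g != 0 by apply: edvd_neq0 gx.
have ng : norm g = norm x.
  apply/eqP; rewrite eqn_leq (edvd_norm x0 gx) /= leqNgt; apply/negP => lt.
  by apply: irr; exists g.
have /norm1P [w w1] : norm z == 1%N.
  move: ng; rewrite xE normM; have := g0; rewrite -norm_gt0; nia.
by exists w; rewrite xE mulrA -w1 mul1r.
Qed.

Lemma eprime_dvdM p x y : eprime p -> edvd p (x * y) -> edvd p x \/ edvd p y.
Proof.
move=> [_ _ pP] pxy; have [c|] := pP x; last by left.
by right; apply: gauss pxy.
Qed.

Definition cubefree c := c != 0 /\ forall x, edvd (x ^+ 3) c -> norm x = 1%N.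

(** Nonunit cubes are split off as long as one divides x; each time the norm drops at least by the
    factor 2^3. *)
Lemma cubefree_decomp x : x != 0 -> exists c w, [/\ x = c * w ^+ 3, w != 0 & cubefree c].
Proof.
have [n] := ubnP (norm x); elim: n x => // n IH x lt_x x0.
case: (classic (cubefree x)) => [cx|].
  by exists x, 1; split=> //; rewrite ?oner_neq0 //; ring.
move=> ncf; have [y [z xE] y1] : exists2 y, edvd (y ^+ 3) x & norm y <> 1%N.
  apply: NNPP => H; apply: ncf; split=> // y yx.
  by apply: NNPP => y1; apply: H; exists y.
have : x != 0 by []. rewrite xE mulf_eq0 negb_or expf_eq0 /= => /andP[z0 y0].
have [||c [w [zE w0 cf]]] := IH z.
- suff lt : (norm z < norm x)%N by exact: leq_trans lt lt_x.
  rewrite xE normM normX.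
  rewrite -!norm_gt0 in z0 y0; have y2 : (2 <= norm y)%N by lia.
  have : (2 ^ 3 <= norm y ^ 3)%N by rewrite leq_exp2r.
  move: (norm y ^ 3)%N => t; nia.
- by [].
exists c, (w * y); split=> //; first by rewrite zE; ring.
by rewrite mulf_neq0.
Qed.

Lemma cubefree_dvd c x : cubefree c -> edvd x c -> cubefree x.
Proof.
move=> [c0 cf] xc; split; first exact: edvd_neq0 xc.
by move=> y yx; apply: cf; apply: edvd_trans xc.
Qed.

(** A prime p with p^3 dividing x y divides one factor, so it is coprime to the other one, and p^3
    divides the first alone. *)
Lemma cubefreeM x y : ecoprime x y -> cubefree x -> cubefree y -> cubefree (x * y).
Proof.
move=> cxy [x0 fx] [y0 fy]; split; first by rewrite mulf_neq0.
move=> z zxy; apply/eqP/negPn/negP => z1.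
have xy0 : x * y != 0 by rewrite mulf_neq0.
have z0 : z != 0.
  by have := edvd_neq0 xy0 zxy; rewrite expf_eq0.
have [p pp pz] := eprime_exists z0 z1.
have p3 : edvd (p ^+ 3) (x * y).
  by apply: edvd_trans zxy; case: pz => u ->; exists (u ^+ 3); rewrite exprMn.
have pd : edvd p (x * y).
  by apply: edvd_trans p3; exists (p ^+ 2); rewrite exprSr.
have [_ p1 _] := pp.
have main a b : ecoprime a b -> (forall w, edvd (w ^+ 3) a -> norm w = 1%N) ->
    edvd (p ^+ 3) (a * b) -> edvd p a -> False.
  move=> cab fa p3ab pa; have cpb := ecoprime_dvd pa cab.
  have : edvd (p ^+ 3) a.
    apply: gauss (ecoprime_sym _) _; last by rewrite mulrC; exact: p3ab.
    by apply: ecoprimeX; apply: ecoprime_sym.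
  by move/fa/eqP; rewrite (negbTE p1).
have [px|py] := eprime_dvdM pp pd; first exact: (main x y).
by apply: (main y x) => //; [exact: ecoprime_sym | rewrite mulrC].
Qed.

(** The cube-free part is unique up to a unit: once e and f are made coprime, e^3 divides d and f^3
    divides c, so both are units. *)
Lemma cubefree_assoc c d e f : cubefree c -> cubefree d -> e != 0 -> f != 0 ->
  e ^+ 3 * c = f ^+ 3 * d -> edvd c d /\ edvd d c.
Proof.
move=> [c0 cf] [d0 df] e0 f0.
have [|g [e' [f' [g0 -> ->]]]] := @reduce_coprime e f; first by rewrite e0.
move=> cop E0; have {E0} E : e' ^+ 3 * c = f' ^+ 3 * d.
  by apply: (mulfI (expf_neq0 3 g0)); rewrite mulrA [RHS]mulrA -!exprMn.
have half a b x y : ecoprime a b -> a ^+ 3 * x = b ^+ 3 * y -> edvd (b ^+ 3) x.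
  move=> cab Exy; apply: gauss (_ : ecoprime (b ^+ 3) (a ^+ 3)) _.
    by apply/ecoprimeX/ecoprime_sym/ecoprimeX.
  by rewrite Exy mulrC; exists y.
have fin a b x y : norm a = 1%N -> a ^+ 3 * x = b ^+ 3 * y -> edvd y x.
  move=> /eqP/norm1P[z z1] Exy; exists (z ^+ 3 * b ^+ 3).
  by rewrite -mulrA -Exy mulrA -exprMn -z1 expr1n mul1r.
have ne : norm e' = 1%N by apply/df/(half f' e' _ c); [exact: ecoprime_sym|].
have nf : norm f' = 1%N by apply/cf/(half e' f' _ d).
by split; [apply: (fin f' e') | apply: (fin e' f')].
Qed.

(** * Counting divisors *)

Lemma mem_box (B : nat) (x : int) : `|x| <= B%:Z -> x \in box B.
Proof.
move=> xB; apply/mapP; exists `|(x + B%:Z)%R|%N; last by lia.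
by rewrite mem_iota; lia.
Qed.
Lemma size_box B : size (box B) = (2 * B).+1.
Proof. by rewrite size_map size_iota. Qed.

Definition ball (t : nat) : seq eis :=
  [seq Eis a b | a <- box (2 * t), b <- box (2 * t)].
Lemma size_ball t : size (ball t) = ((4 * t).+1 ^ 2)%N.
Proof. by rewrite size_allpairs !size_box mulnA mulnn. Qed.
Lemma mem_ball t x : (norm x <= t)%N -> x \in ball t.
Proof.
move=> xt; have {xt} : normz x <= t%:Z by rewrite -normE.
case: x => a b; rewrite /normz /= !expr2 => xt.
(* Completing the square: 4 (a^2 - a b + b^2) = 3 a^2 + (2 b - a)^2. *)
have a2 : 3 * (a * a) <= 4 * t%:Z by have := sqr_ge0 (2 * b - a); rewrite expr2; lia.
have b2 : 3 * (b * b) <= 4 * t%:Z by have := sqr_ge0 (2 * a - b); rewrite expr2; lia.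
apply/allpairsP; exists (a, b); split=> //=; apply: mem_box.
  by have [a0|a0] := leP 0 a; have [|a3] := leP `|a| (2 * t)%N%:Z => //; nia.
by have [b0|b0] := leP 0 b; have [|b3] := leP `|b| (2 * t)%N%:Z => //; nia.
Qed.

Definition divisor_list (d : eis) (L : seq eis) := forall x, edvd x d -> x \in L.

(** A divisor of d p coprime to p divides d by Gauss; any other one is p times a divisor of d. *)
Lemma divisor_list_prime p d L : eprime p -> divisor_list d L ->
  divisor_list (d * p) (L ++ [seq p * x | x <- L]).
Proof.
move=> pp dL x xdp; rewrite mem_cat; have [p0 _ pP] := pp.
have [cpx|[y xE]] := pP x.
  by rewrite dL //; apply: gauss (ecoprime_sym cpx) _; rewrite mulrC.
rewrite orbC xE mulrC map_f //; apply: dL.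
case: xdp => z E; exists z; apply: (mulIf p0); rewrite E xE; ring.
Qed.

(* Each prime of the list occurs at most twice in d, and splitting off one
   prime factor at most doubles the list of divisors. *)
Lemma divisor_list_smooth l d : cubefree d ->
  (forall p, eprime p -> edvd p d -> p \in l) ->
  exists2 L, (size L <= 25 * 4 ^ size l)%N & divisor_list d L.
Proof.
elim: l d => [|p l IH] d cfd pl.
  (* With no primes left d is a unit, and so are its divisors; 25 is the size of [ball 1]. *)
  exists (ball 1); first by rewrite size_ball.
  have d1 : norm d == 1%N.
    apply/negPn/negP => d1; have [p pp pd] := eprime_exists (proj1 cfd) d1.
    by have := pl p pp pd.
  by move=> x xd; apply: mem_ball; rewrite -(eqP d1) edvd_norm // (proj1 cfd).
have le4 m : (25 * 4 ^ m <= 25 * 4 ^ m.+1)%N by rewrite expnS; lia.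
have other d' : edvd d' d -> ~ edvd p d' ->
    exists2 L, (size L <= 25 * 4 ^ size l)%N & divisor_list d' L.
  move=> d'd npd'; apply: IH; first exact: cubefree_dvd d'd.
  move=> q pq qd'; have := pl q pq (edvd_trans qd' d'd).
  by rewrite inE => /orP[/eqP qp|//]; case: npd'; rewrite -qp.
case: (classic (edvd p d)) => [[d1 dE]|npd]; last first.
  have [L sL dL] := other d (edvd_refl d) npd.
  by exists L => //=; apply: leq_trans sL (le4 _).
case: (classic (eprime p)) => [pp|npp]; last first.
  have [||L sL dL] := IH d => //.
    move=> q pq qd; have := pl q pq qd.
    by rewrite inE => /orP[/eqP qp|//]; case: npp; rewrite -qp.
  by exists L => //=; apply: leq_trans sL (le4 _).
case: (classic (edvd p d1)) => [[d2 d1E]|npd1]; last first.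
  have [|L sL dL] := other d1 _ npd1; first by exists p; rewrite dE mulrC.
  exists (L ++ [seq p * x | x <- L]); last by rewrite dE; apply: divisor_list_prime.
  rewrite size_cat size_map /= expnS addnn -mul2n.
  by apply: leq_trans (leq_mul (leqnn 2) sL) _; move: (4 ^ _)%N => t; lia.
(* Here p^2 is split off; p does not divide d2, since otherwise p^3 would divide the cube-free d. *)
have [||L sL dL] := other d2.
- by exists (p ^+ 2); rewrite dE d1E; ring.
- move=> [d3 d2E]; have [_ /eqP p1 _] := pp; apply: p1; apply: (proj2 cfd).
  by exists d3; rewrite dE d1E d2E; ring.
exists (let L1 := L ++ [seq p * x | x <- L] in L1 ++ [seq p * x | x <- L1]).
  rewrite /= !(size_cat, size_map) expnS !addnn -!mul2n mulnA.
  by apply: leq_trans (leq_mul (leqnn (2 * 2)) sL) _; move: (4 ^ _)%N => t; lia.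
by rewrite dE d1E; apply: divisor_list_prime => //; apply: divisor_list_prime.
Qed.

Lemma leq_expn a b n : (a <= b)%N -> (a ^ n <= b ^ n)%N.
Proof. by case: n => // n ab; rewrite leq_exp2r. Qed.

(* A prime factor p with norm p >= 2^n is free of charge: it doubles the number of
   divisors, hence multiplies its n-th power by 2^n <= norm p. *)
Lemma divisor_bound n : exists K, forall d, cubefree d ->
  exists2 L, (size L ^ n <= K * norm d)%N & divisor_list d L.
Proof.
(* This K settles every d all of whose prime factors have norm below 2^n. *)
pose K := ((25 * 4 ^ size (ball (2 ^ n))) ^ n)%N; exists K => d.
have [m] := ubnP (norm d); elim: m d => // m IH d ltd cfd.
case: (classic (exists p, [/\ eprime p, edvd p d & (2 ^ n <= norm p)%N])); last first.
  move=> small; have [|L sL dL] := @divisor_list_smooth (ball (2 ^ n)) d cfd.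
    move=> p pp pd; apply: mem_ball; rewrite leqNgt; apply/negP => lt.
    by apply: small; exists p; split=> //; apply: ltnW.
  exists L => //; apply: (@leq_trans K); first exact: leq_expn.
  by rewrite leq_pmulr // norm_gt0 (proj1 cfd).
move=> [p [pp [d' dE] np]]; have [p0 p1 _] := pp.
have [d0 _] := cfd.
have d'd : edvd d' d by exists p; rewrite dE mulrC.
have [||L sL dL] := IH d'.
- have := edvd_neq0 d0 d'd; have := p0; rewrite -!norm_gt0 => np0 nd0.
  suff lt : (norm d' < norm d)%N by exact: leq_trans lt ltd.
  by rewrite dE normM; move: p1 => /eqP; nia.
- exact: cubefree_dvd d'd.
exists (L ++ [seq p * x | x <- L]); last by rewrite dE; apply: divisor_list_prime.
rewrite size_cat size_map addnn -mul2n expnMn dE normM mulnA mulnC.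
by rewrite leq_mul // .
Qed.

(** The zero sum makes the v_j pairwise coprime, so the product of their cube-free parts c_j is
    again cube-free. It agrees with d up to cubes, hence is associated to d: each c_j divides d, and
    d divides v0 v1 v2. *)
Lemma class_decomp d e f v0 v1 v2 : cubefree d -> e != 0 -> f != 0 ->
    v0 != 0 -> v1 != 0 -> v2 != 0 -> ecoprime v0 v1 -> v0 + v1 + v2 = 0 ->
    e ^+ 3 * (v0 * v1 * v2) = f ^+ 3 * d ->
  (norm d <= norm v0 * norm v1 * norm v2)%N /\
  exists c0 c1 c2 w0 w1 w2,
  [/\ v0 = c0 * w0 ^+ 3, v1 = c1 * w1 ^+ 3, v2 = c2 * w2 ^+ 3 &
      [/\ edvd c0 d, edvd c1 d & edvd c2 d]].
Proof.
move=> cfd e0 f0 v00 v10 v20 c01 v012 E.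
have v2E : v2 = - (v0 + v1) by apply/eqP; rewrite -subr_eq0 opprK addrC v012.
have [u [v uv]] := c01.
have c02 : ecoprime v0 v2 by exists (u - v), (- v); rewrite -uv v2E; ring.
have c12 : ecoprime v1 v2 by exists (v - u), (- u); rewrite -uv v2E; ring.
have [c0 [w0 [E0 w00 cf0]]] := cubefree_decomp v00.
have [c1 [w1 [E1 w10 cf1]]] := cubefree_decomp v10.
have [c2 [w2 [E2 w20 cf2]]] := cubefree_decomp v20.
have dv0 : edvd c0 v0 by exists (w0 ^+ 3); rewrite E0 mulrC.
have dv1 : edvd c1 v1 by exists (w1 ^+ 3); rewrite E1 mulrC.
have dv2 : edvd c2 v2 by exists (w2 ^+ 3); rewrite E2 mulrC.
have cop x y x' y' : ecoprime x y -> edvd x' x -> edvd y' y -> ecoprime x' y'.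
  move=> cxy x'x y'y; apply: ecoprime_dvd x'x _; apply: ecoprime_sym.
  by apply: ecoprime_dvd y'y _; apply: ecoprime_sym.
have k01 := cop _ _ _ _ c01 dv0 dv1.
have k02 := cop _ _ _ _ c02 dv0 dv2.
have k12 := cop _ _ _ _ c12 dv1 dv2.
have cfc : cubefree (c0 * c1 * c2).
  apply: cubefreeM => //; last exact: cubefreeM.
  by apply: ecoprime_sym; apply: ecoprimeM; apply: ecoprime_sym.
have ew0 : e * w0 * w1 * w2 != 0 by rewrite !mulf_neq0.
have [|cd dc] := cubefree_assoc cfc cfd ew0 f0; first by rewrite -E E0 E1 E2; ring.
split.
  rewrite -!normM; apply: edvd_norm; first by rewrite !mulf_neq0.
  by apply: edvd_trans dc _; exists ((w0 * w1 * w2) ^+ 3); rewrite E0 E1 E2; ring.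
exists c0, c1, c2, w0, w1, w2; split=> //; split; apply: edvd_trans cd.
- by exists (c1 * c2); ring.
- by exists (c0 * c2); ring.
- by exists (c0 * c1); ring.
Qed.

(** * The descent identity *)

Notation triple R := (R * R * R)%type.

(** With p = (y Z, z X, x Y) and q = (z Y, x Z, y X) this is p1 p2 q3 + p1 q2 p3 + q1 p2 p3, the
    coefficient of -T in the product of the p_i - T q_i. Exchanging P and Q gives the coefficient of
    T^2. *)
Definition Sf (R : comNzRingType) (P Q : triple R) : R :=
  let: (x, y, z) := P in let: (X, Y, Z) := Q in
  y ^+ 2 * z * (X ^+ 2 * Z) + x ^+ 2 * y * (Z ^+ 2 * Y) + z ^+ 2 * x * (Y ^+ 2 * X).

Definition Uf (R : comNzRingType) (om : R) (P Q : triple R) : R :=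
  let: (x, y, z) := P in let: (X, Y, Z) := Q in
  (y * Z - om * (z * Y)) * (z * X - om * (x * Z)) * (x * Y - om * (y * X)).

(** The first coordinate of the cross product of the vectors of cubes of P and Q. *)
Definition Af (R : comNzRingType) (P Q : triple R) : R :=
  let: (x, y, z) := P in let: (X, Y, Z) := Q in
  y ^+ 3 * Z ^+ 3 - z ^+ 3 * Y ^+ 3.

Definition curve (R : comNzRingType) (a P : triple R) : bool :=
  let: (a0, a1, a2) := a in let: (x, y, z) := P in
  a0 * x ^+ 3 + a1 * y ^+ 3 + a2 * z ^+ 3 == 0.

Definition prod3 (R : comNzRingType) (P : triple R) : R := P.1.1 * P.1.2 * P.2.

(* The case of the base point (1, 1, 1) on a x^3 + b y^3 - (a + b) z^3 = 0; the point
   (x, y, z) lies on this curve iff its cubes are y^3 + (a + b) k, y^3, y^3 + a k for some k. *)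
Lemma descent_identity (R : comNzRingType) (om a b k K x y z X Y Z E1 E2 F1 F2 : R) :
    om ^+ 2 = - 1 - om ->
    z ^+ 3 = y ^+ 3 + a * k -> x ^+ 3 = y ^+ 3 + (a + b) * k ->
    Z ^+ 3 = Y ^+ 3 + a * K -> X ^+ 3 = Y ^+ 3 + (a + b) * K ->
    E1 = a * b * (- a - b) * k ^+ 2 * K -> E2 = a * b * (- a - b) * k * K ^+ 2 ->
    F1 = a * b * (- a - b) * k * K ^+ 2 -> F2 = a * b * (- a - b) * k ^+ 2 * K ->
  let u0 := Uf 1 (1, 1, 1) (x, y, z) in
  let u1 := Uf om (1, 1, 1) (x, y, z) in
  let u2 := Uf (om ^+ 2) (1, 1, 1) (x, y, z) in
  let v0 := Uf 1 (1, 1, 1) (X, Y, Z) in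
  let v1 := Uf om (1, 1, 1) (X, Y, Z) in
  let v2 := Uf (om ^+ 2) (1, 1, 1) (X, Y, Z) in
  (u1 ^+ 2 * u2 * (v0 ^+ 2 * v2) + u0 ^+ 2 * u1 * (v2 ^+ 2 * v1)
   + u2 ^+ 2 * u0 * (v1 ^+ 2 * v0)
   + 3%:R * E1 * (u1 * v0 * v2 + u0 * v1 * v2 + u2 * v0 * v1)
   + 3%:R * E2 * (u1 * u2 * v0 + u0 * u1 * v2 + u0 * u2 * v1)
   + 6%:R * (u0 * u1 * u2) * (v0 * v1 * v2)) * Uf om (x, y, z) (X, Y, Z) =
  - (v1 ^+ 2 * v2 * (u0 ^+ 2 * u2) + v0 ^+ 2 * v1 * (u2 ^+ 2 * u1)
   + v2 ^+ 2 * v0 * (u1 ^+ 2 * u0)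
   + 3%:R * F1 * (v1 * u0 * u2 + v0 * u1 * u2 + v2 * u0 * u1)
   + 3%:R * F2 * (v1 * v2 * u0 + v0 * v1 * u2 + v0 * v2 * u1)
   + 6%:R * (v0 * v1 * v2) * (u0 * u1 * u2)) * Uf (om ^+ 2) (x, y, z) (X, Y, Z).
Proof.
(* A polynomial identity modulo the relations for om^2 and for the cubes, which serve as rewriting
   rules. *)
by move=> Hom H1 H2 H3 H4 -> -> -> ->; rewrite /Uf /=; ring: Hom H1 H2 H3 H4.
Qed.

(** The factor g^3 h^3 c^2 turns the cubes of the three summands of [Sf] into monomials in the u_j
    and v_j. The mixed terms also contain g^2 h c w^2 x and g h^2 c w x^2, which are the quantities
    [E1], [E2] of [descent_identity]. *)
Lemma Sf_cube (R : comNzRingType) (g h c0 c1 c2 w0 w1 w2 x0 x1 x2 : R) :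
  let u0 := g * c0 * w0 ^+ 3 in let u1 := g * c1 * w1 ^+ 3 in
  let u2 := g * c2 * w2 ^+ 3 in
  let v0 := h * c0 * x0 ^+ 3 in let v1 := h * c1 * x1 ^+ 3 in
  let v2 := h * c2 * x2 ^+ 3 in
  let c := c0 * c1 * c2 in let w := w0 * w1 * w2 in let x := x0 * x1 * x2 in
  g ^+ 3 * h ^+ 3 * c ^+ 2 * Sf (w0, w1, w2) (x0, x1, x2) ^+ 3 =
  u1 ^+ 2 * u2 * (v0 ^+ 2 * v2) + u0 ^+ 2 * u1 * (v2 ^+ 2 * v1)
   + u2 ^+ 2 * u0 * (v1 ^+ 2 * v0)
   + 3%:R * (g ^+ 2 * h * c * w ^+ 2 * x) * (u1 * v0 * v2 + u0 * v1 * v2 + u2 * v0 * v1)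
   + 3%:R * (g * h ^+ 2 * c * w * x ^+ 2) * (u1 * u2 * v0 + u0 * u1 * v2 + u0 * u2 * v1)
   + 6%:R * (u0 * u1 * u2) * (v0 * v1 * v2).
Proof. by rewrite /Sf /=; ring. Qed.

Arguments Sf : simpl never.
Arguments Uf : simpl never.
Arguments Af : simpl never.

Section Descent.
Variables (R : idomainType) (om : R).
Hypothesis om2 : om ^+ 2 = - 1 - om.

Definition diff0 := @Uf R 1.
Definition diff1 := Uf om.
Definition diff2 := Uf (om ^+ 2).

(** The projective point (U_0 : U_1 : U_2) is the image (c_j w_j^3) of w; g is the scaling
    factor. *)
Definition is_lift (c : triple R) (P Q w : triple R) (g : R) :=
  [/\ diff0 P Q = g * c.1.1 * w.1.1 ^+ 3, diff1 P Q = g * c.1.2 * w.1.2 ^+ 3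
    & diff2 P Q = g * c.2 * w.2 ^+ 3].

(** The vectors of cubes of P and Q are both orthogonal to a, so their cross product is proportional
    to a. *)
Lemma curve_Af (a P Q : triple R) : curve a P -> curve a Q ->
  a.1.1 * (P.1.1 ^+ 3 * Q.1.2 ^+ 3 - P.1.2 ^+ 3 * Q.1.1 ^+ 3) = a.2 * Af P Q /\
  a.1.1 * (P.2 ^+ 3 * Q.1.1 ^+ 3 - P.1.1 ^+ 3 * Q.2 ^+ 3) = a.1.2 * Af P Q.
Proof.
case: a P Q => [[a b] c] [[x y] z] [[X Y] Z] /= /eqP E /eqP F; rewrite /Af; split.
  apply/eqP; rewrite -subr_eq0; apply/eqP.
  transitivity ((a * x ^+ 3 + b * y ^+ 3 + c * z ^+ 3) * Y ^+ 3
    - (a * X ^+ 3 + b * Y ^+ 3 + c * Z ^+ 3) * y ^+ 3); first by ring.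
  by rewrite E F !mul0r subr0.
apply/eqP; rewrite -subr_eq0; apply/eqP.
transitivity ((a * X ^+ 3 + b * Y ^+ 3 + c * Z ^+ 3) * z ^+ 3
  - (a * x ^+ 3 + b * y ^+ 3 + c * z ^+ 3) * Z ^+ 3); first by ring.
by rewrite E F !mul0r subr0.
Qed.

(* Only the cubes of the coordinates of w and x are determined by P and Q, and the
   last two hypotheses select the right cube roots of unity.  The identity reduces to the
   base point (1, 1, 1) by rescaling the coordinates, the factor a.1.1 being there
   to avoid denominators. *)
Lemma descent (a c O P Q w x : triple R) (g h e f : R) :
    prod3 a != 0 -> prod3 c != 0 -> prod3 O != 0 -> g != 0 -> h != 0 -> f != 0 ->
    curve a O -> curve a P -> curve a Q ->
    is_lift c O P w g -> is_lift c O Q x h ->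
    e ^+ 3 * prod3 c = f ^+ 3 * prod3 a ->
    f * (g * a.1.1 * prod3 w) = e * Af O P ->
    f * (h * a.1.1 * prod3 x) = e * Af O Q ->
  Sf w x ^+ 3 * diff1 P Q = - (Sf x w ^+ 3 * diff2 P Q).
Proof.
case: a => [[a b] b']; case: c => [[c0 c1] c2]; case: O => [[x1 y1] z1].
case: P => [[x0 y0] z0]; case: Q => [[X0 Y0] Z0].
case: w => [[w0 w1] w2]; case: x => [[v0 v1] v2].
move=> Ha Hc HO g0 h0 f0 CO CP CQ.
have [AP1 AP2] := curve_Af CO CP; have [AQ1 AQ2] := curve_Af CO CQ.
rewrite /is_lift /diff0 /diff1 /diff2 /prod3 /=; rewrite /prod3 /= in Ha Hc HO AP1 AP2 AQ1 AQ2.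
move=> [LP0 LP1 LP2] [LQ0 LQ1 LQ2] Hef NP NQ.
set A := Af _ _ in AP1 AP2 NP; set B := Af _ _ in AQ1 AQ2 NQ.
have a0 : a != 0 by move: Ha; rewrite !mulf_eq0 !negb_or => /andP[/andP[]].
pose pi := x1 * y1 * z1.
pose t := a ^+ 3 * pi.
have t0 : t != 0 by rewrite mulf_neq0 // expf_neq0.
(* [NP] and [NQ] trade the products of the coordinates of the two lifts for A and B, and [Hef]
   trades c0 c1 c2 for a b b'; the powers of e and f cancel. *)
have E1 : a ^+ 3 * (g ^+ 2 * h * (c0 * c1 * c2) * (w0 * w1 * w2) ^+ 2 * (v0 * v1 * v2))
   = a * b * b' * A ^+ 2 * B.
  apply: (mulfI (expf_neq0 3 f0)).
  transitivity ((f * (g * a * (w0 * w1 * w2))) ^+ 2 * (f * (h * a * (v0 * v1 * v2)))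
     * (c0 * c1 * c2)); first by ring.
  rewrite NP NQ; transitivity (A ^+ 2 * B * (e ^+ 3 * (c0 * c1 * c2))); first by ring.
  by rewrite Hef; ring.
have E2 : a ^+ 3 * (g * h ^+ 2 * (c0 * c1 * c2) * (w0 * w1 * w2) * (v0 * v1 * v2) ^+ 2)
   = a * b * b' * A * B ^+ 2.
  apply: (mulfI (expf_neq0 3 f0)).
  transitivity ((f * (g * a * (w0 * w1 * w2))) * (f * (h * a * (v0 * v1 * v2))) ^+ 2
     * (c0 * c1 * c2)); first by ring.
  rewrite NP NQ; transitivity (A * B ^+ 2 * (e ^+ 3 * (c0 * c1 * c2))); first by ring.
  by rewrite Hef; ring.
(* Each coordinate is divided by that of O and multiplied by a x1 y1 z1, which moves O to (1, 1,
   1). *)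
pose x := a * (x0 * y1 * z1); pose y := a * (y0 * x1 * z1); pose z := a * (z0 * x1 * y1).
pose X := a * (X0 * y1 * z1); pose Y := a * (Y0 * x1 * z1); pose Z := a * (Z0 * x1 * y1).
pose k := a ^+ 2 * A; pose K := a ^+ 2 * B.
pose aa := a * x1 ^+ 3; pose bb := b * y1 ^+ 3.
have cc : - aa - bb = b' * z1 ^+ 3.
  by move: CO => /= /eqP /(canRL (addrK _)); rewrite /aa /bb sub0r -opprD => ->; ring.
have H1 : z ^+ 3 = y ^+ 3 + aa * k by rewrite /z /y /k /aa /A /Af; ring.
have H3 : Z ^+ 3 = Y ^+ 3 + aa * K by rewrite /Z /Y /K /aa /B /Af; ring.
have H2 : x ^+ 3 = y ^+ 3 + (aa + bb) * k.
  have -> : aa + bb = - (b' * z1 ^+ 3) by rewrite -cc; ring.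
  have -> : - (b' * z1 ^+ 3) * k = - (b' * A) * (a ^+ 2 * z1 ^+ 3) by rewrite /k; ring.
  by rewrite -AP1 /x /y; ring.
have H4 : X ^+ 3 = Y ^+ 3 + (aa + bb) * K.
  have -> : aa + bb = - (b' * z1 ^+ 3) by rewrite -cc; ring.
  have -> : - (b' * z1 ^+ 3) * K = - (b' * B) * (a ^+ 2 * z1 ^+ 3) by rewrite /K; ring.
  by rewrite -AQ1 /X /Y; ring.
have scale1 w' : Uf w' (1, 1, 1) (x, y, z) = t * Uf w' (x1, y1, z1) (x0, y0, z0).
  by rewrite /t /pi /x /y /z /Uf /=; ring.
have scale2 w' : Uf w' (1, 1, 1) (X, Y, Z) = t * Uf w' (x1, y1, z1) (X0, Y0, Z0).
  by rewrite /t /pi /X /Y /Z /Uf /=; ring.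
have scale3 w' : Uf w' (x, y, z) (X, Y, Z) = a ^+ 6 * pi ^+ 4 * Uf w' (x0, y0, z0) (X0, Y0, Z0).
  by rewrite /pi /x /y /z /X /Y /Z /Uf /=; ring.
have F1 : (t * g) ^+ 2 * (t * h) * (c0 * c1 * c2) * (w0 * w1 * w2) ^+ 2 * (v0 * v1 * v2)
    = aa * bb * (- aa - bb) * k ^+ 2 * K.
  rewrite cc; transitivity (t ^+ 2 * pi * (a ^+ 3 *
    (g ^+ 2 * h * (c0 * c1 * c2) * (w0 * w1 * w2) ^+ 2 * (v0 * v1 * v2)))).
    by rewrite /t; ring.
  by rewrite E1 /t /pi /aa /bb /k /K; ring.
have F2 : (t * g) * (t * h) ^+ 2 * (c0 * c1 * c2) * (w0 * w1 * w2) * (v0 * v1 * v2) ^+ 2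
    = aa * bb * (- aa - bb) * k * K ^+ 2.
  rewrite cc; transitivity (t ^+ 2 * pi * (a ^+ 3 *
    (g * h ^+ 2 * (c0 * c1 * c2) * (w0 * w1 * w2) * (v0 * v1 * v2) ^+ 2))).
    by rewrite /t; ring.
  by rewrite E2 /t /pi /aa /bb /k /K; ring.
have F3 : (t * h) ^+ 2 * (t * g) * (c0 * c1 * c2) * (v0 * v1 * v2) ^+ 2 * (w0 * w1 * w2)
    = aa * bb * (- aa - bb) * k * K ^+ 2 by rewrite -F2; ring.
have F4 : (t * h) * (t * g) ^+ 2 * (c0 * c1 * c2) * (v0 * v1 * v2) * (w0 * w1 * w2) ^+ 2
    = aa * bb * (- aa - bb) * k ^+ 2 * K by rewrite -F1; ring.
have := descent_identity om2 H1 H2 H3 H4 F1 F2 F3 F4; cbv zeta.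
have M r (c w : R) : t * (r * c * w ^+ 3) = t * r * c * w ^+ 3 by ring.
rewrite !scale1 !scale2 LP0 LP1 LP2 LQ0 LQ1 LQ2 !M.
rewrite -(Sf_cube (t * g) (t * h)) -(Sf_cube (t * h) (t * g)) !scale3.
set p := a ^+ 6 * pi ^+ 4; set c := c0 * c1 * c2.
have q0 : (t * g) ^+ 3 * (t * h) ^+ 3 * c ^+ 2 * p != 0.
  have p0 : p != 0 by apply: mulf_neq0; apply: expf_neq0.
  by apply: mulf_neq0 p0; apply: mulf_neq0; [apply: mulf_neq0|]; apply: expf_neq0 => //;
    apply: mulf_neq0.
move=> E; apply: (mulfI q0).
by transitivity ((t * g) ^+ 3 * (t * h) ^+ 3 * c ^+ 2 *
  Sf (w0, w1, w2) (v0, v1, v2) ^+ 3 * (p * Uf om (x0, y0, z0) (X0, Y0, Z0)));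
  [|rewrite E]; ring.
Qed.
End Descent.

(** * Counting in sequences *)

(** Finite choice: the witnesses of a propositional relation are collected along T and kept as
    pairs. *)
Lemma seq_choice (A B : eqType) (T : seq A) (r : A -> B -> Prop) :
  (forall x, x \in T -> exists y, r x y) ->
  exists2 L : seq (A * B), [seq z.1 | z <- L] = T & forall z, z \in L -> r z.1 z.2.
Proof.
elim: T => [|x T IH] H; first by exists [::].
have [y rxy] := H x (mem_head _ _).
have [z zT|L LT rL] := IH; first by apply: H; rewrite inE zT orbT.
exists ((x, y) :: L); first by rewrite /= LT.
by move=> z; rewrite inE => /orP[/eqP ->|/rL].
Qed.

(** Greedy choice: keep the first element and discard the at most n elements related to it, itself
    included. *)
Lemma transversal (A : eqType) (e : rel A) n (s : seq A) :
    (forall x, x \in s -> e x x) -> (forall x, x \in s -> (count (e x) s <= n)%N) ->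
  exists r, [/\ {subset r <= s}, pairwise (fun x y => ~~ e x y) r &
                (size s <= n * size r)%N].
Proof.
have [m] := ubnP (size s); elim: m s => // m IH [|x s] lts exx cnt.
  by exists [::]; split.
have /= cx := cnt x (mem_head _ _); rewrite exx ?mem_head // in cx.
pose t := filter (fun y => ~~ e x y) s.
have ts : {subset t <= x :: s}.
  by move=> y; rewrite mem_filter inE => /andP[_ ->]; rewrite orbT.
have sz : size s = (count (e x) s + size t)%N by rewrite size_filter count_predC.
have [|y /ts|y ty|r [rt pr sr]] := IH t; last 1 first.
- exists (x :: r); split.
  + by move=> y; rewrite inE => /orP[/eqP ->|/rt/ts //]; exact: mem_head.
  + rewrite /= pr andbT; apply/allP => y /rt.
    by rewrite mem_filter => /andP[].
  + by rewrite /= sz mulnS -addSn leq_add.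
- by apply: (@leq_ltn_trans (size s)); rewrite // sz leq_addl.
- exact: exx.
- apply: leq_trans (cnt y (ts y ty)).
  by rewrite /= count_filter (leq_trans _ (leq_addl _ _)) //; apply: sub_count => z /andP[].
Qed.

Lemma pairwise_keys (A K : eqType) (r : rel A) (f : A -> K) s (k : seq K) :
    pairwise r s -> (forall x, x \in s -> f x \in k) ->
    (forall x y, x \in s -> y \in s -> r x y -> f x <> f y) ->
  (size s <= size k)%N.
Proof.
move=> ps fk inj; rewrite -(size_map f); apply: uniq_leq_size.
  rewrite uniq_pairwise pairwise_map.
  apply: (sub_in_pairwise (P := mem s)) ps; last exact/allP.
  by move=> x y xs ys rxy; apply/eqP; apply: inj.
by move=> _ /mapP[x xs ->]; apply: fk.
Qed.

Lemma size_fibres (A K : eqType) (f : A -> K) (s : seq A) (k : seq K) n :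
    (forall x, x \in s -> f x \in k) ->
    (forall c, c \in k -> (count (fun x => f x == c) s <= n)%N) ->
  (size s <= n * size k)%N.
Proof.
elim: k s => [|c k IH] s fk cnt.
  by case: s fk {cnt} => // x s /(_ x (mem_head _ _)).
rewrite -(count_predC (fun x => f x == c)) mulnS leq_add ?cnt ?mem_head //.
rewrite -size_filter; apply: IH.
  move=> x; rewrite mem_filter => /andP[/= xc /fk].
  by rewrite inE (negbTE xc).
move=> c' c'k; rewrite count_filter.
apply: leq_trans (cnt c' _); last by rewrite inE c'k orbT.
by apply: sub_count => x /andP[].
Qed.

(** * Heights of differences *)

Definition om : eis := Eis 0 1.
Lemma om2 : om ^+ 2 = - 1 - om. Proof. by apply: eis_ext. Qed.
Notation pt := (triple eis).
Notation U0 := (@diff0 eis).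
Notation U1 := (diff1 om).
Notation U2 := (diff2 om).
Notation lift := (is_lift om).

Lemma cube_eq (x y : eis) : x ^+ 3 = y ^+ 3 -> [\/ y = x, y = om * x | y = om ^+ 2 * x].
Proof.
move=> E; have : (y - x) * (y - om * x) * (y - om ^+ 2 * x) = 0.
  by transitivity (y ^+ 3 - x ^+ 3); [ring: om2 | rewrite E subrr].
move/eqP; rewrite !mulf_eq0 !subr_eq0.
by case/orP => [/orP[]|] /eqP ->; [constructor 1|constructor 2|constructor 3].
Qed.

(** Vanishing coordinates are excluded because [descent] rescales by the coordinates of the base
    point; such points are counted in [size_zero_coord]. *)
Definition goodpt (a P : pt) := curve a P && (prod3 P != 0).
(* On a curve, [sim P Q] says that P and Q agree up to cube roots of unity, see
   [Af_prop]. *)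
Definition sim (P Q : pt) := Af P Q == 0.

(** Expand the product of the p_i - om^j q_i: the outer terms cancel, because p1 p2 p3 = q1 q2 q3
    and om^(3j) = 1. *)
Lemma U_S P Q :
  [/\ U0 P Q = Sf Q P - Sf P Q, U1 P Q = om ^+ 2 * Sf Q P - om * Sf P Q &
      U2 P Q = om * Sf Q P - om ^+ 2 * Sf P Q].
Proof.
case: P Q => [[x y] z] [[X Y] Z]; rewrite /diff0 /diff1 /diff2 /Uf /Sf.
by split; ring: om2.
Qed.

Lemma U_sum P Q : U0 P Q + U1 P Q + U2 P Q = 0.
Proof. by have [-> -> ->] := U_S P Q; ring: om2. Qed.

Lemma U_S_prod P Q : U0 P Q * U1 P Q * U2 P Q = Sf Q P ^+ 3 - Sf P Q ^+ 3.
Proof. by have [-> -> ->] := U_S P Q; ring: om2. Qed.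

(** The product over j of the p_i - om^j q_i is p_i^3 - q_i^3, so U0 U1 U2 is the product of the
    three coordinates of the cross product in [curve_Af]. *)
Lemma U_prod a P Q : curve a P -> curve a Q ->
  a.1.1 ^+ 3 * (U0 P Q * U1 P Q * U2 P Q) = prod3 a * Af P Q ^+ 3.
Proof.
move=> cP cQ; have [A1 A2] := curve_Af cP cQ; rewrite /prod3.
transitivity (a.1.1 * Af P Q * (a.1.1 * (P.1.1 ^+ 3 * Q.1.2 ^+ 3 - P.1.2 ^+ 3 * Q.1.1 ^+ 3)) *
  (a.1.1 * (P.2 ^+ 3 * Q.1.1 ^+ 3 - P.1.1 ^+ 3 * Q.2 ^+ 3))); last by rewrite A1 A2; ring.
case: P Q {cP cQ A1 A2} => [[x y] z] [[X Y] Z].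
by rewrite /diff0 /diff1 /diff2 /Uf /Af /=; ring: om2.
Qed.

Lemma prod3_neq0 (P : pt) : prod3 P != 0 = [&& P.1.1 != 0, P.1.2 != 0 & P.2 != 0].
Proof. by rewrite /prod3 !mulf_eq0 !negb_or andbA. Qed.

Lemma sim_U a P Q : prod3 a != 0 -> curve a P -> curve a Q ->
  sim P Q = (U0 P Q * U1 P Q * U2 P Q == 0).
Proof.
move=> a0 cP cQ; have a1 : a.1.1 != 0 by move: a0; rewrite prod3_neq0 => /and3P[].
have : (a.1.1 ^+ 3 * (U0 P Q * U1 P Q * U2 P Q) == 0) = (prod3 a * Af P Q ^+ 3 == 0).
  by rewrite (U_prod cP cQ).
by rewrite mulf_eq0 expf_eq0 (negbTE a1) /= [RHS]mulf_eq0 (negbTE a0) [RHS]expf_eq0 /= => ->.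
Qed.

Lemma nsim_U a P Q : prod3 a != 0 -> curve a P -> curve a Q -> ~~ sim P Q ->
  [/\ U0 P Q != 0, U1 P Q != 0 & U2 P Q != 0].
Proof.
move=> a0 cP cQ; rewrite (sim_U a0 cP cQ) !mulf_eq0 !negb_or.
by move=> /andP[/andP[-> ->] ->].
Qed.

(* The exponent m replaces the m-th root of the bound h, keeping everything in nat. *)
Definition height_le m h (P Q : pt) := exists g v0 v1 v2,
  [/\ g != 0, U0 P Q = g * v0, U1 P Q = g * v1, U2 P Q = g * v2 &
  [/\ ecoprime v0 v1, (norm v0 ^ m <= h)%N, (norm v1 ^ m <= h)%N & (norm v2 ^ m <= h)%N]].

Lemma U_reduce P Q : U0 P Q != 0 -> exists g v0 v1 v2,
  [/\ g != 0, U0 P Q = g * v0, U1 P Q = g * v1, U2 P Q = g * v2 &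
      ecoprime v0 v1 /\ v0 + v1 + v2 = 0].
Proof.
move=> u0; have [|g [v0 [v1 [g0 E0 E1 cop]]]] := @reduce_coprime (U0 P Q) (U1 P Q).
  by rewrite u0.
exists g, v0, v1, (- v0 - v1); split=> //; last by split=> //; ring.
have /eqP := U_sum P Q; rewrite addrC addr_eq0 => /eqP ->.
by rewrite E0 E1; ring.
Qed.

Lemma double_add_le_max i j : (2 * (i + j) <= 4 * maxn i j)%N.
Proof. by rewrite -(mulnA 2 2) leq_mul2l mul2n -addnn leq_add // ?leq_maxl ?leq_maxr. Qed.

(** Let s, t be S(w,x), S(x,w) in lowest terms. The descent relation gives s^3 | v2 and t^3 | v1, so
    the norms of s and t are bounded by cube roots. Up to a common factor the U_j(w,x) are
    combinations of s and t with unit coefficients, of norm at most 4 times the larger norm; 4^(3 m)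
    = 64^m. *)
Lemma height_step a c P Q w x m h :
    prod3 a != 0 -> curve a P -> curve a Q -> ~~ sim P Q ->
    prod3 c != 0 -> curve c w -> curve c x -> ~~ sim w x ->
    Sf w x ^+ 3 * U1 P Q = - (Sf x w ^+ 3 * U2 P Q) ->
  height_le m h P Q -> height_le (3 * m) (64 ^ m * h) w x.
Proof.
move=> a0 cP cQ nPQ c0 cw cx nwx E [g [v0 [v1 [v2 [g0 E0 E1 E2 [_ _ n1 n2]]]]]].
have [_] := nsim_U a0 cP cQ nPQ; rewrite E1 E2 !mulf_eq0 !negb_or.
move=> /andP[_ v10] /andP[_ v20].
have [u0 u1 u2] := nsim_U c0 cw cx nwx.
have [S0 S1 S2] := U_S w x.
have st0 : (Sf w x != 0) || (Sf x w != 0).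
  by rewrite -negb_and; apply: contra u0 => /andP[/eqP s /eqP t]; rewrite S0 s t subrr.
have [k [s [t [k0 sE tE cst]]]] := reduce_coprime st0.
have E' : s ^+ 3 * v1 = - (t ^+ 3 * v2).
  have kg : k ^+ 3 * g != 0 by rewrite mulf_neq0 ?expf_neq0.
  apply: (mulfI kg); move: E; rewrite sE tE E1 E2 => E.
  transitivity ((k * s) ^+ 3 * (g * v1)); first by ring.
  by rewrite E; ring.
have bound (y v : eis) n : v != 0 -> edvd (y ^+ 3) v -> (norm v ^ m <= n)%N ->
    (norm y ^ (3 * m) <= n)%N.
  move=> v0' /(edvd_norm v0') yv; apply: leq_trans.
  by rewrite expnM; apply: leq_expn; rewrite -normX.
have cst3 : ecoprime (s ^+ 3) (t ^+ 3).
  by apply/ecoprimeX/ecoprime_sym/ecoprimeX/ecoprime_sym.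
have ns : (norm s ^ (3 * m) <= h)%N.
  apply: (bound s v2) => //; apply: gauss cst3 _.
  by exists (- v1); apply: oppr_inj; rewrite -E'; ring.
have nt : (norm t ^ (3 * m) <= h)%N.
  apply: (bound t v1) => //; apply: gauss (ecoprime_sym cst3) _.
  by exists (- v2); rewrite E'; ring.
have [G [z0 [z1 [z2 [G0 F0 F1 F2 [[u [v cz]] z012]]]]]] := U_reduce u0.
have bd (p q : eis) : norm p = 1%N -> norm q = 1%N ->
    (norm (p * t + q * s)%R ^ (3 * m) <= 64 ^ m * h)%N.
  move=> p1 q1; apply: (@leq_trans ((4 * maxn (norm s) (norm t)) ^ (3 * m))).
    apply: leq_expn; apply: leq_trans (norm_leD _ _) _.
    rewrite !normM p1 q1 !mul1n.
    by rewrite addnC; exact: double_add_le_max.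
  rewrite expnMn expnM leq_mul //.
  by case: (leqP (norm s) (norm t)).
(* G is a combination of U0(w,x) and U1(w,x), both multiples of k; hence the reduced triple divides
   the U_j(w,x) / k entrywise. *)
have Gk : edvd k G.
  exists (u * (t - s) + v * (om ^+ 2 * t - om * s)).
  have E3 := cz; rewrite -[G]mulr1 -cz mulrDr.
  transitivity (u * U0 w x + v * U1 w x); first by rewrite F0 F1; ring.
  by rewrite S0 S1 sE tE; ring.
have fin z l : l != 0 -> G * z = k * l -> (norm l ^ (3 * m) <= 64 ^ m * h)%N ->
    (norm z ^ (3 * m) <= 64 ^ m * h)%N.
  move=> l0 Gz; apply: leq_trans; apply: leq_expn; apply: edvd_norm => //.
  case: Gk => q GE; exists q; apply: (mulfI k0); rewrite -Gz GE; ring.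
have ln z l U : U != 0 -> U = G * z -> U = k * l -> l != 0 /\ G * z = k * l.
  move=> U_0 <- Ul; split=> //; move: U_0; rewrite Ul.
  by apply: contraNneq => ->; rewrite mulr0.
exists G, z0, z1, z2; split=> //; split; first by exists u, v.
- have [|l0 e0] := ln z0 (1 * t + (-1) * s) _ u0 F0; first by rewrite S0 sE tE; ring.
  by apply: fin e0 _ => //; apply: bd.
- have [|l0 e0] := ln z1 (om ^+ 2 * t + (- om) * s) _ u1 F1.
    by rewrite S1 sE tE; ring.
  by apply: fin e0 _ => //; apply: bd.
- have [|l0 e0] := ln z2 (om * t + (- om ^+ 2) * s) _ u2 F2.
    by rewrite S2 sE tE; ring.
  by apply: fin e0 _ => //; apply: bd.
Qed.

(** * One descent step *)

Lemma lift_prod c O P w g : lift c O P w g ->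
  U0 O P * U1 O P * U2 O P = g ^+ 3 * prod3 c * prod3 w ^+ 3.
Proof. by move=> [-> -> ->]; rewrite /prod3; ring. Qed.

Lemma lift_neq0 a c O P w g : prod3 a != 0 -> curve a O -> curve a P -> ~~ sim O P ->
  lift c O P w g -> [/\ g != 0, prod3 c != 0, prod3 w != 0 & curve c w].
Proof.
move=> a0 cO cP nOP L; have := lift_prod L.
have [u0 u1 u2] := nsim_U a0 cO cP nOP; move=> E.
have : g ^+ 3 * prod3 c * prod3 w ^+ 3 != 0 by rewrite -E !mulf_neq0.
rewrite mulf_eq0 [X in X || _]mulf_eq0 !expf_eq0 /= !negb_or -andbA => /and3P[g0 c0 w0].
split=> //; have [L0 L1 L2] := L; have := U_sum O P; rewrite L0 L1 L2.
case: c w {L c0 w0 E L0 L1 L2} => [[c0 c1] c2] [[w0 w1] w2] /= E.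
apply/eqP; apply: (mulfI g0); rewrite mulr0 -[RHS]E; ring.
Qed.

Lemma om3 : om ^+ 3 = 1. Proof. by apply: eis_ext. Qed.

(** Comparing [lift_prod] with [U_prod] fixes the product of the coordinates of w up to a cube root
    of unity. Multiplying one coordinate by a power of om achieves the normalization required in
    [descent], with e and f read off from P0. *)
Lemma normalize a c O P0 w0 g0 P w g :
    prod3 a != 0 -> curve a O -> curve a P0 -> curve a P -> ~~ sim O P0 -> ~~ sim O P ->
    lift c O P0 w0 g0 -> lift c O P w g ->
  exists2 w', lift c O P w' g &
    Af O P0 * (g * a.1.1 * prod3 w') = a.1.1 * g0 * prod3 w0 * Af O P.
Proof.
move=> a0 cO cP0 cP n0 n L0 L.
have [g00 c0 w00 _] := lift_neq0 a0 cO cP0 n0 L0.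
have /cube_eq [E|E|E] :
    (Af O P0 * (g * a.1.1 * prod3 w)) ^+ 3 = (a.1.1 * g0 * prod3 w0 * Af O P) ^+ 3.
- apply: (mulfI (mulf_neq0 a0 c0)).
  transitivity (prod3 a * Af O P0 ^+ 3 *
      (a.1.1 ^+ 3 * (g ^+ 3 * prod3 c * prod3 w ^+ 3))); first by ring.
  rewrite -(lift_prod L) (U_prod cO cP) -(U_prod cO cP0) (lift_prod L0); ring.
- by exists w.
- exists (om * w.1.1, w.1.2, w.2).
    have [L1 L2 L3] := L; split=> //=; rewrite L1.
    by rewrite exprMn om3 mul1r.
  by rewrite E /prod3 /=; ring.
- exists (om ^+ 2 * w.1.1, w.1.2, w.2).
    have [L1 L2 L3] := L; split=> //=; rewrite L1.
    by rewrite exprMn -exprM mulnC exprM om3 expr1n mul1r.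
  by rewrite E /prod3 /=; ring.
Qed.

(* Among the x with [sim w x], these are the translates (w0, om^j w1, om^(2j) w2) of w
   by the kernel of the 3-isogeny. *)
Definition same_coset (w x : pt) :=
  w.1.1 * w.1.2 * x.2 ^+ 2 = x.1.1 * x.1.2 * w.2 ^+ 2.

Lemma three_neq0 : 3%:R != 0 :> eis. Proof. by []. Qed.

(** In the same coset the three summands of S(w,x) coincide, so S(w,x) is 3 times a nonzero
    product. *)
Lemma same_coset_Sf c w x : prod3 c != 0 -> goodpt c w -> goodpt c x ->
  sim w x -> same_coset w x -> Sf w x != 0.
Proof.
move=> c0 /andP[cw w0] /andP[cx x0] swx sc.
move: w0 x0; rewrite !prod3_neq0 => /and3P[w0 w1 w2] /and3P[x0 x1 x2].
case: w x cw cx swx sc w0 w1 w2 x0 x1 x2 => [[w0 w1] w2] [[x0 x1] x2].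
rewrite /sim /same_coset /Af /= => cw cx /eqP; rewrite /= => A sc *.
pose p1 := w1 * x2; pose q1 := w2 * x1; pose p2 := w2 * x0; pose q2 := w0 * x2.
pose p3 := w0 * x1; pose q3 := w1 * x0.
have p10 : p1 != 0 by rewrite mulf_neq0.
have q20 : q2 != 0 by rewrite mulf_neq0.
have E12 : p1 * q2 = q1 * p2.
  by transitivity (w0 * w1 * x2 ^+ 2); [rewrite /p1 /q2; ring | rewrite sc /q1 /p2; ring].
have E13 : q1 * p3 = p1 * q3.
  apply: (mulfI (expf_neq0 2 p10)).
  have c1 : p1 ^+ 3 = q1 ^+ 3.
    by apply/eqP; rewrite -subr_eq0; apply/eqP; rewrite -A /p1 /q1; ring.
  have pq : p1 * p2 * p3 = q1 * q2 * q3 by rewrite /p1 /p2 /p3 /q1 /q2 /q3; ring.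
  have pq2 : p1 ^+ 2 * p3 = q1 ^+ 2 * q3.
    apply: (mulfI q20); transitivity (p1 * q2 * (p1 * p3)); first by ring.
    rewrite E12; transitivity (q1 * (p1 * p2 * p3)); first by ring.
    by rewrite pq; ring.
  transitivity (q1 * (p1 ^+ 2 * p3)); first by ring.
  by rewrite pq2; transitivity (q1 ^+ 3 * q3); [|rewrite -c1]; ring.
have -> : Sf (w0, w1, w2) (x0, x1, x2) = 3%:R * (p1 * p2 * q3).
  rewrite /Sf; transitivity (p1 * p2 * q3 + p1 * q2 * p3 + q1 * p3 * p2).
    by rewrite /p1 /p2 /p3 /q1 /q2 /q3; ring.
  rewrite E12 E13; have -> : q1 * p2 * p3 = q1 * p3 * p2 by ring.
  by rewrite E13; ring.
by rewrite !mulf_neq0 // three_neq0.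
Qed.

(** Elements differing by the kernel of the isogeny have equal images: here S(w,x)^3 = S(x,w)^3 is
    nonzero, so [descent] gives U1(P,Q) = - U2(P,Q), that is, U0(P,Q) = 0. *)
Lemma same_coset_sim a c O P Q w x g h e f :
    prod3 a != 0 -> goodpt a O -> goodpt a P -> goodpt a Q -> ~~ sim O P -> ~~ sim O Q ->
    lift c O P w g -> lift c O Q x h -> f != 0 ->
    e ^+ 3 * prod3 c = f ^+ 3 * prod3 a ->
    f * (g * a.1.1 * prod3 w) = e * Af O P ->
    f * (h * a.1.1 * prod3 x) = e * Af O Q ->
    sim w x -> same_coset w x -> sim P Q.
Proof.
move=> a0 /andP[cO O0] /andP[cP P0] /andP[cQ Q0] nP nQ LP LQ f0 Hef NP NQ swx sc.
have [g0 c0 w0 cw] := lift_neq0 a0 cO cP nP LP.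
have [h0 _ x0 cx] := lift_neq0 a0 cO cQ nQ LQ.
have E := descent om2 a0 c0 O0 g0 h0 f0 cO cP cQ LP LQ Hef NP NQ.
have S0 : Sf w x != 0 by apply: (same_coset_Sf c0) => //; apply/andP.
have S3 : Sf x w ^+ 3 = Sf w x ^+ 3.
  apply/eqP; rewrite -subr_eq0 -U_S_prod -(sim_U c0) //.
rewrite (sim_U a0 cP cQ) !mulf_eq0 -orbA; apply/orP; left.
have := U_sum P Q; move: E; rewrite S3 -mulrN => /(mulfI (expf_neq0 3 S0)) ->.
by rewrite subrK => ->.
Qed.

Lemma sim_trans u w x : prod3 u != 0 -> sim u w -> sim u x -> sim w x.
Proof.
rewrite prod3_neq0 => /and3P[_ u1 u2]; rewrite /sim.
case: u w x u1 u2 => [[u0 u1] u2] [[w0 w1] w2] [[x0 x1] x2] /= u10 u20.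
rewrite /Af !subr_eq0 => /eqP A /eqP B; apply/eqP.
apply: (mulfI (expf_neq0 3 (mulf_neq0 u10 u20))).
transitivity ((u2 ^+ 3 * w1 ^+ 3) * (u1 ^+ 3 * x2 ^+ 3)); first by ring.
by rewrite -A B; ring.
Qed.

Lemma sim_refl P : sim P P.
Proof. by case: P => [[x y] z]; rewrite /sim /Af mulrC subrr. Qed.

Lemma sim_sym P Q : sim P Q = sim Q P.
Proof.
case: P Q => [[x y] z] [[X Y] Z]; rewrite /sim /Af !subr_eq0 eq_sym.
by rewrite mulrC [X in _ == X]mulrC.
Qed.

Lemma pairwise_mem (A : eqType) (r : rel A) s x y :
  pairwise r s -> x \in s -> y \in s -> x <> y -> r x y \/ r y x.
Proof.
elim: s => //= z s IH /andP[/allP zs ps]; rewrite !inE.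
case/orP => [/eqP ->|xs] /orP[/eqP ->|ys] // nxy.
- by left; apply: zs.
- by right; apply: zs.
- exact: IH.
Qed.

(** For [sim u w] the two monomials have equal cubes, and the key is the exponent of om in their
    ratio; it labels the three cosets. *)
Definition coset_key (u w : pt) : nat :=
  let X := u.1.1 * u.1.2 * w.2 ^+ 2 in let Y := w.1.1 * w.1.2 * u.2 ^+ 2 in
  if Y == X then 0%N else if Y == om * X then 1%N else 2%N.

Lemma coset_keyE c u w : prod3 c != 0 -> goodpt c u -> goodpt c w -> sim u w ->
  w.1.1 * w.1.2 * u.2 ^+ 2 = om ^+ coset_key u w * (u.1.1 * u.1.2 * w.2 ^+ 2).
Proof.
move=> c0 /andP[cu _] /andP[cw _] /eqP A; have [_] := curve_Af cu cw.
rewrite A mulr0 => /eqP; have /and3P[c1 _ _] : [&& c.1.1 != 0, c.1.2 != 0 & c.2 != 0].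
  by rewrite -prod3_neq0.
rewrite mulf_eq0 (negbTE c1) subr_eq0 /= => /eqP B.
have C : u.1.2 ^+ 3 * w.2 ^+ 3 = u.2 ^+ 3 * w.1.2 ^+ 3.
  by apply/eqP; rewrite -subr_eq0; move/eqP: A; case: (u) (w) => [[? ?] ?] [[? ?] ?].
rewrite /coset_key /=; set X := u.1.1 * u.1.2 * w.2 ^+ 2.
set Y := w.1.1 * w.1.2 * u.2 ^+ 2.
have /cube_eq XY : X ^+ 3 = Y ^+ 3.
  transitivity ((u.1.1 ^+ 3 * w.2 ^+ 3) * (u.1.2 ^+ 3 * w.2 ^+ 3)); first by rewrite /X; ring.
  by rewrite -B C /Y; ring.
have [->|n0] := eqVneq Y X; first by rewrite mul1r.
have [->|n1] := eqVneq Y (om * X); first by rewrite expr1.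
by case: XY => // E; [rewrite E eqxx in n0 | rewrite E eqxx in n1].
Qed.

Lemma coset_key_same c u w x : prod3 c != 0 -> goodpt c u -> goodpt c w -> goodpt c x ->
  sim u w -> sim u x -> coset_key u w = coset_key u x -> same_coset w x.
Proof.
move=> c0 gu gw gx suw sux E.
have := coset_keyE c0 gu gw suw; have := coset_keyE c0 gu gx sux; rewrite E.
move: (om ^+ _) => z Ex Ew; have /andP[_] := gu; rewrite prod3_neq0 => /and3P[_ _ u2].
apply: (mulfI (expf_neq0 2 u2)).
transitivity (w.1.1 * w.1.2 * u.2 ^+ 2 * x.2 ^+ 2); first by ring.
rewrite Ew; transitivity (x.1.1 * x.1.2 * u.2 ^+ 2 * w.2 ^+ 2); last by ring.
by rewrite Ex; ring.
Qed.

Definition nsim P Q := ~~ sim P Q.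

(* Points P whose lifts are related by [sim] fall into three cosets, and P is unique
   in each of them: this is the factor 3. *)
Lemma class_step a c O T m h :
    prod3 a != 0 -> goodpt a O -> (forall P, P \in T -> goodpt a P && nsim O P) ->
    pairwise nsim T -> (forall P, P \in T -> exists w g, lift c O P w g) ->
    (forall P Q, P \in T -> Q \in T -> nsim P Q -> height_le m h P Q) ->
  exists W, [/\ (size T <= 3 * size W)%N,
    forall w, w \in W -> goodpt c w /\ exists P g, P \in T /\ lift c O P w g,
    pairwise nsim W &
    forall w x, w \in W -> x \in W -> nsim w x -> height_le (3 * m) (64 ^ m * h) w x].
Proof.
move=> a0 gO; case: T => [|P0 T0]; first by exists [::].
set T := P0 :: T0 => gT pT liftT hT.
have P0T : P0 \in T by rewrite mem_head.
have [w0 [g0 L0]] := liftT P0 P0T.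
have /andP[gP0 nP0] := gT P0 P0T.
have [cO cP0] : curve a O /\ curve a P0 by case/andP: gO; case/andP: gP0.
(* The first point fixes e and f: at P0 with lift w0 the normalization holds trivially. *)
pose e := a.1.1 * g0 * prod3 w0; pose f := Af O P0.
have f0 : f != 0 by [].
have [_ c0 _ _] := lift_neq0 a0 cO cP0 nP0 L0.
have Hef : e ^+ 3 * prod3 c = f ^+ 3 * prod3 a.
  transitivity (a.1.1 ^+ 3 * (g0 ^+ 3 * prod3 c * prod3 w0 ^+ 3)); first by rewrite /e; ring.
  by rewrite -(lift_prod L0) (U_prod cO cP0) mulrC.
pose r P w := exists2 g, lift c O P w g & f * (g * a.1.1 * prod3 w) = e * Af O P.
have [|L LT rL] := @seq_choice _ _ T r.
  move=> P PT; have [w [g LP]] := liftT P PT; have /andP[/andP[cP _] nP] := gT P PT.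
  by have [w' Lw' Nw'] := normalize a0 cO cP0 cP nP0 nP L0 LP; exists w', g.
have LT1 z : z \in L -> z.1 \in T by move=> zL; rewrite -LT map_f.
have gw z : z \in L -> goodpt c z.2.
  move=> zL; have [g Lg _] := rL z zL; have /andP[/andP[cP _] nP] := gT _ (LT1 z zL).
  by have [_ _ n1 n2] := lift_neq0 a0 cO cP nP Lg; apply/andP.
have inj z t : z \in L -> t \in L -> nsim z.1 t.1 -> sim z.2 t.2 -> same_coset z.2 t.2 -> False.
  move=> zL tL /negP n s sc; apply: n.
  have [g Lg Ng] := rL z zL; have [k Lk Nk] := rL t tL.
  have /andP[gz nz] := gT _ (LT1 z zL); have /andP[gt nt] := gT _ (LT1 t tL).
  exact: same_coset_sim a0 gO gz gt nz nt Lg Lk f0 Hef Ng Nk s sc.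
have pL : pairwise (fun z t => nsim z.1 t.1) L by rewrite -LT pairwise_map in pT.
(* At most three lifts are similar to a given one, since by [inj] their coset keys differ. *)
have [||r1 [r1L pr szL]] := @transversal _ (fun z t => sim z.2 t.2) 3 L.
- by move=> z _; apply: sim_refl.
- move=> u uL; rewrite -size_filter.
  apply: (@pairwise_keys _ _ (fun z t => nsim z.1 t.1)
    (fun z => coset_key u.2 z.2) _ [:: 0; 1; 2]%N).
  + by apply: subseq_pairwise pL; apply: filter_subseq.
  + by move=> z _; rewrite /coset_key; case: ifP => // _; case: ifP.
  + move=> z t; rewrite !mem_filter => /andP[uz zL] /andP[ut tL] nzt E.
    have /andP[_ u0] := gw u uL.
    apply: (inj z t) => //; first exact: sim_trans uz ut.
    exact: coset_key_same c0 (gw u uL) (gw z zL) (gw t tL) uz ut E.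
exists [seq z.2 | z <- r1]; split.
- by rewrite size_map -LT size_map.
- move=> _ /mapP[z /r1L zL ->]; split; first exact: gw.
  by have [g Lg _] := rL z zL; exists z.1, g; split=> //; apply: LT1.
- by rewrite pairwise_map.
- move=> _ _ /mapP[z /r1L zL ->] /mapP[t /r1L tL ->] nzt.
  have [g Lg Ng] := rL z zL; have [k Lk Nk] := rL t tL.
  have /andP[gz nz] := gT _ (LT1 z zL); have /andP[gt nt] := gT _ (LT1 t tL).
  have /andP[cz _] := gz; have /andP[ct _] := gt; have /andP[_ O0] := gO.
  have /andP[wz _] := gw z zL; have /andP[wt _] := gw t tL.
  have [g00 _ _ _] := lift_neq0 a0 cO cz nz Lg; have [k00 _ _ _] := lift_neq0 a0 cO ct nt Lk.
  have E := descent om2 a0 c0 O0 g00 k00 f0 cO cz ct Lg Lk Hef Ng Nk.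
  have nzt1 : nsim z.1 t.1.
    have zt : z <> t by move=> zt; move: nzt; rewrite zt /nsim sim_refl.
    by case: (pairwise_mem pL zL tL zt) => //; rewrite /nsim sim_sym.
  exact: height_step a0 cz ct nzt1 c0 wz wt nzt E (hT _ _ (LT1 z zL) (LT1 t tL) nzt1).
Qed.

(** * Iterating the descent *)

(** Partitions T by a key c and applies [class_step] to each class. The relation r is left open:
    [bound_base] prescribes the lift (1, 1, 1), [bound] admits any lift. *)
Lemma split_step a O T m h (r : pt -> pt -> Prop) (keys : seq pt) n :
    prod3 a != 0 -> goodpt a O -> (forall P, P \in T -> goodpt a P && nsim O P) ->
    pairwise nsim T ->
    (forall P Q, P \in T -> Q \in T -> nsim P Q -> height_le m h P Q) ->
    (forall P c, r P c -> exists w g, lift c O P w g) ->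
    (forall P, P \in T -> exists2 c, c \in keys & r P c) ->
    (forall c W, c \in keys ->
      (forall w, w \in W -> goodpt c w /\
         exists P g, [/\ P \in T, r P c & lift c O P w g]) ->
      pairwise nsim W ->
      (forall w x, w \in W -> x \in W -> nsim w x -> height_le (3 * m) (64 ^ m * h) w x) ->
      (size W <= n)%N) ->
  (size T <= 3 * n * size keys)%N.
Proof.
move=> a0 gO gT pT hT rlift rT bW.
have [|L LT rL] := @seq_choice _ _ T (fun P c => c \in keys /\ r P c).
  by move=> P /rT[c ck rc]; exists c.
have LT1 z : z \in L -> z.1 \in T by move=> zL; rewrite -LT map_f.
rewrite -LT size_map; apply: (size_fibres (f := snd)) => [z /rL[]//|c ck].
rewrite -size_filter -(size_map fst); set Tc := map _ _.
have TcP P : P \in Tc -> P \in T /\ r P c.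
  case/mapP=> z; rewrite mem_filter => /andP[/eqP zc zL] ->.
  by split; [exact: LT1 | rewrite -zc; case: (rL z zL)].
have [||||W [sW gW pW hW]] := @class_step a c O Tc m h a0 gO.
- by move=> P /TcP[PT _]; apply: gT.
- rewrite pairwise_map; rewrite -LT pairwise_map in pT.
  by apply: subseq_pairwise pT; apply: filter_subseq.
- by move=> P /TcP[_ /rlift].
- by move=> P Q /TcP[PT _] /TcP[QT _]; apply: hT.
apply: leq_trans sW _; rewrite leq_mul2l /=; apply: (bW c) => // w /gW[gw [P [g [PT Lg]]]].
by split=> //; exists P, g; have [] := TcP P PT.
Qed.

Lemma nat_root m b : (0 < m)%N ->
  exists t, (t ^ m <= b)%N /\ forall x, (x ^ m <= b)%N -> (x <= t)%N.
Proof.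
move=> m0; have ex0 : exists t, (t ^ m <= b)%N by exists 0%N; rewrite exp0n.
have ub t : (t ^ m <= b)%N -> (t <= b)%N.
  by apply: leq_trans; case: t => // t; apply: (leq_pexp2l (ltn0Sn t) m0).
by case: (ex_maxnP ex0 ub) => t tb max; exists t.
Qed.

(** Here the key of P is its reduced triple (v0, v1, v2) itself, with lift (1, 1, 1). Its entries
    have norm at most t, the integer m-th root of h, so there are (4 t + 1)^6 keys. *)
Lemma bound_base m : (0 < m)%N -> exists2 C, (0 < C)%N & forall a T h,
    prod3 a != 0 -> (0 < h)%N -> (forall P, P \in T -> goodpt a P) -> pairwise nsim T ->
    (forall P Q, P \in T -> Q \in T -> nsim P Q -> height_le m h P Q) ->
  (size T ^ m <= C * h ^ 6)%N.
Proof.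
move=> m0; exists ((4 * 5 ^ 6) ^ m)%N; first by rewrite expn_gt0.
move=> a T h a0 h0; case: T => [|O T] gT pT hT; first by rewrite exp0n.
have [t [th tmax]] := nat_root h m0.
have t0 : (0 < t)%N by apply: tmax; rewrite exp1n.
have OT : O \in O :: T by rewrite mem_head.
have sub P : P \in T -> P \in O :: T by rewrite inE => ->; rewrite orbT.
have /andP[/allP OTn pT'] := pT.
have gO := gT O OT.
pose b := ball t.
pose keys : seq pt := [seq (xy, z) | xy <- [seq (x, y) | x <- b, y <- b], z <- b].
have szk : size keys = ((4 * t).+1 ^ 6)%N.
  by rewrite size_allpairs size_allpairs size_ball -!expnD.
have szT : (size T <= 3 * 1 * size keys)%N.
  apply: (@split_step a O T m h (fun P c => exists g, lift c O P (1, 1, 1) g)) => //.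
  - by move=> P PT; rewrite gT ?sub //=; apply: OTn.
  - by move=> P Q PT QT; apply: hT; apply: sub.
  - by move=> P c [g Lg]; exists (1, 1, 1), g.
  - move=> P PT; have [g [v0 [v1 [v2 [_ E0 E1 E2 [_ n0 n1 n2]]]]]] :=
      hT O P OT (sub P PT) (OTn P PT).
    exists (v0, v1, v2); last by exists g; split; rewrite /= expr1n mulr1.
    have mb v : (norm v ^ m <= h)%N -> v \in b by move=> nv; apply: mem_ball; apply: tmax.
    by apply: allpairs_f; [apply: allpairs_f|]; apply: mb.
  - move=> c W _ gW pW _.
    (* Comparison with the lift (1, 1, 1) makes any two elements of W similar, so W has at most one
       element. *)
    have flat w : w \in W -> w.1.2 ^+ 3 = w.2 ^+ 3.
      move=> wW; have [gw [P [g [PT [k Lk] Lg]]]] := gW w wW.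
      have /andP[cO _] := gO; have /andP[cP _] := gT P (sub P PT).
      have [g0 c0 _ _] := lift_neq0 a0 cO cP (OTn P PT) Lg.
      move: c0; rewrite prod3_neq0 => /and3P[_ c1 c2].
      have [_ L1 L2] := Lg; have [_] := Lk; rewrite /= expr1n !mulr1 => K1 K2.
      apply: (mulfI g0); transitivity k.
        by apply: (mulfI c1); rewrite mulrC -mulrA [_ * c.1.2]mulrC mulrA -L1 K1 mulrC.
      by apply: (mulfI c2); rewrite [RHS]mulrC -[RHS]mulrA [_ * c.2]mulrC [RHS]mulrA -L2 K2 mulrC.
    case: W pW flat {gW} => [|w [|x W]] //= /andP[/andP[nwx _] _] flat.
    case/negP: nwx; have := flat w; have := flat x; rewrite !inE !eqxx !orbT /=.
    case: w x {flat} => [[w0 w1] w2] [[x0 x1] x2] /= => E F.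
    by rewrite /sim /Af E // F // subrr.
(* 3 (4 t + 1)^6 plus 1 for the base point, and 4 t + 1 <= 5 t. *)
have fin : (size (O :: T) <= 4 * 5 ^ 6 * t ^ 6)%N.
  rewrite -mulnA -expnMn; apply: (@leq_trans (4 * (4 * t).+1 ^ 6)); last first.
    rewrite leq_mul2l /= leq_expn //; lia.
  by move: szT; rewrite szk /=; have : (0 < (4 * t).+1 ^ 6)%N; [rewrite expn_gt0 | lia].
apply: leq_trans (leq_expn m fin) _.
rewrite expnMn; apply: leq_mul => //; rewrite -expnM [(6 * m)%N]mulnC expnM.
exact: leq_expn.
Qed.

(** The invariant of the iteration: prod(c) agrees with prod(a) up to cubes, so one d and one list
    of its divisors serve at every level. *)
Lemma class_step_type O P c w g a d e f :
    prod3 a != 0 -> prod3 c != 0 -> e != 0 -> f != 0 -> goodpt a O -> goodpt a P -> nsim O P ->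
    e ^+ 3 * prod3 a = f ^+ 3 * d -> lift c O P w g ->
  exists e' f', [/\ e' != 0, f' != 0 & e' ^+ 3 * prod3 c = f' ^+ 3 * d].
Proof.
move=> a0 c0 e0 f0 /andP[cO _] /andP[cP _] nOP E L.
have [g0 _ w0 _] := lift_neq0 a0 cO cP nOP L.
have a1 : a.1.1 != 0 by move: a0; rewrite prod3_neq0 => /and3P[].
exists (e * a.1.1 * g * prod3 w), (f * Af O P); split.
- by apply: mulf_neq0 w0; apply: mulf_neq0 g0; apply: mulf_neq0.
- exact: mulf_neq0.
transitivity (e ^+ 3 * (a.1.1 ^+ 3 * (g ^+ 3 * prod3 c * prod3 w ^+ 3))); first by ring.
rewrite -(lift_prod L) (U_prod cO cP) mulrA E; ring.
Qed.

(** The classes are triples of divisors of d. The bound for the norm of d is the source of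
    uniformity in the coefficients: for integer points it is a power of B. *)
Lemma lift_class a O P d e f :
    prod3 a != 0 -> cubefree d -> e != 0 -> f != 0 -> goodpt a O -> goodpt a P -> nsim O P ->
    e ^+ 3 * prod3 a = f ^+ 3 * d ->
  (norm d <= norm (U0 O P) * norm (U1 O P) * norm (U2 O P))%N /\
  exists c w g, [/\ edvd c.1.1 d, edvd c.1.2 d, edvd c.2 d & lift c O P w g].
Proof.
move=> a0 cfd e0 f0 /andP[cO _] /andP[cP _] nOP E.
have [u0 u1 u2] := nsim_U a0 cO cP nOP.
have [g [v0 [v1 [v2 [g0 E0 E1 E2 [cop v012]]]]]] := U_reduce u0.
have a1 : a.1.1 != 0 by move: a0; rewrite prod3_neq0 => /and3P[].
have [v00 v10 v20] : [/\ v0 != 0, v1 != 0 & v2 != 0].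
  by move: u0 u1 u2; rewrite E0 E1 E2 !mulf_eq0 !negb_or => /andP[_ ->] /andP[_ ->] /andP[_ ->].
have e'0 : e * a.1.1 * g != 0 by rewrite !mulf_neq0.
have f'0 : f * Af O P != 0 by rewrite mulf_neq0.
have [|nd [c0 [c1 [c2 [w0 [w1 [w2 [F0 F1 F2 [d0 d1 d2]]]]]]]]] :=
    class_decomp cfd e'0 f'0 v00 v10 v20 cop v012.
  transitivity (e ^+ 3 * (a.1.1 ^+ 3 * ((g * v0) * (g * v1) * (g * v2)))); first by ring.
  by rewrite -E0 -E1 -E2 (U_prod cO cP) mulrA E; ring.
have le v : (norm v <= norm (g * v)%R)%N by rewrite normM leq_pmull // norm_gt0.
split; first by apply: leq_trans nd _; rewrite E0 E1 E2 !leq_mul ?le.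
by exists (c0, c1, c2), (w0, w1, w2), g; split=> //; split; rewrite /= -?mulrA -?F0 -?F1 -?F2.
Qed.

(** Induction on the number k of descents. Each replaces (m, h) by (3 m, 64^m h) and costs a factor
    4 |L|^3: at most |L|^3 classes, three cosets in each, and room for the base point. *)
Lemma bound k m : (0 < m)%N -> exists2 C, (0 < C)%N & forall d L a T h e f,
    cubefree d -> divisor_list d L -> prod3 a != 0 -> e != 0 -> f != 0 ->
    e ^+ 3 * prod3 a = f ^+ 3 * d ->
    (0 < h)%N -> (forall P, P \in T -> goodpt a P) -> pairwise nsim T ->
    (forall P Q, P \in T -> Q \in T -> nsim P Q -> height_le m h P Q) ->
  (size T ^ (m * 3 ^ k) <= C * size L ^ (3 * k * (m * 3 ^ k)) * h ^ 6)%N.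
Proof.
elim: k m => [|k IH] m m0.
  have [C C0 HC] := bound_base m0; exists C => // d L a T h e f _ _ a0 _ _ _ h0 gT pT hT.
  by rewrite muln1 muln0 mul0n muln1; apply: HC a0 h0 gT pT hT.
have [|C C0 HC] := IH (3 * m)%N; first by rewrite muln_gt0.
pose M := (m * 3 ^ k.+1)%N.
have ME : (3 * m * 3 ^ k)%N = M by rewrite /M expnS mulnCA mulnA.
have M0 : (0 < M)%N by rewrite muln_gt0 m0 expn_gt0.
exists (4 ^ M * C * (64 ^ m) ^ 6)%N; first by rewrite !muln_gt0 C0 !expn_gt0.
move=> d L a T h e f cfd dL a0 e0 f0 E h0; rewrite -/M.
have L0 : (0 < size L)%N.
  by have := dL 1 _; case: L {dL} => [|x L] // /(_ _); apply; exists d; rewrite mulr1.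
(* The inductive bound for the M-th power of the number of lifts in one class; n below is its
   integer M-th root. *)
pose B := (C * size L ^ (3 * k * M) * (64 ^ m * h) ^ 6)%N.
have B0 : (0 < B)%N by rewrite !(muln_gt0, expn_gt0) C0 L0 h0.
case: T => [|O T] gT pT hT; first by rewrite exp0n.
have OT : O \in O :: T by rewrite mem_head.
have sub P : P \in T -> P \in O :: T by rewrite inE => ->; rewrite orbT.
have /andP[/allP OTn pT'] := pT.
have gO := gT O OT.
have [n [nB nmax]] := nat_root B M0.
have n0 : (0 < n)%N by apply: nmax; rewrite exp1n.
pose keys : seq pt := [seq (xy, z) | xy <- [seq (x, y) | x <- L, y <- L], z <- L].
have szk : size keys = (size L ^ 3)%N.
  by rewrite size_allpairs size_allpairs !expnS expn0 muln1 mulnA.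
have szT : (size T <= 3 * n * size keys)%N.
  apply: (@split_step a O T m h (fun P c => exists w g, lift c O P w g)) => //.
  - by move=> P PT; rewrite gT ?sub //=; apply: OTn.
  - by move=> P Q PT QT; apply: hT; apply: sub.
  - move=> P PT; have [_ [c [w [g [d0 d1 d2 Lg]]]]] :=
      lift_class a0 cfd e0 f0 gO (gT P (sub P PT)) (OTn P PT) E.
    exists c; last by exists w, g.
    case: c d0 d1 d2 {Lg} => [[c0 c1] c2] /= d0 d1 d2.
    by apply: allpairs_f; [apply: allpairs_f|]; apply: dL.
  - move=> c [|w W] _ gW pW hW //.
    have [_ [P [g [PT _ Lg]]]] := gW w (mem_head _ _).
    have gP := gT P (sub P PT).
    have /andP[cO _] := gO; have /andP[cP _] := gP.
    have [_ c0 _ _] := lift_neq0 a0 cO cP (OTn P PT) Lg.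
    have [e' [f' [e'0 f'0 E']]] := class_step_type a0 c0 e0 f0 gO gP (OTn P PT) E Lg.
    apply: nmax; rewrite -ME.
    apply: leq_trans (HC d L c (w :: W) (64 ^ m * h)%N e' f' cfd dL c0 e'0 f'0 E' _ _ pW hW) _.
    + by rewrite muln_gt0 expn_gt0.
    + by move=> x /gW[].
    + by rewrite /B ME.
have fin : (size (O :: T) <= 4 * n * size L ^ 3)%N.
  move: szT; rewrite szk /=.
  have : (0 < n * size L ^ 3)%N by rewrite muln_gt0 n0 expn_gt0 L0.
  rewrite -!mulnA; move: (n * _)%N (size T); lia.
apply: leq_trans (leq_expn M fin) _; rewrite 2!expnMn -expnM.
apply: (@leq_trans (4 ^ M * B * size L ^ (3 * M))); first by rewrite leq_mul // leq_mul.
have aux (x1 x2 x3 x4 x5 y : nat) :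
  (x1 * (x2 * x4 * (x3 * y)) * x5 = x1 * x2 * x3 * (x5 * x4) * y)%N by ring.
by rewrite /B expnMn mulnS mulnDl expnD aux.
Qed.

(** * Integer points *)

Definition emb (t : int * int * int) : pt := (Eis t.1.1 0, Eis t.1.2 0, Eis t.2 0).

Lemma EisM m n : Eis m 0 * Eis n 0 = Eis (m * n) 0.
Proof. by apply: eis_ext; rewrite !eisE /=; ring. Qed.
Lemma EisD m n : Eis m 0 + Eis n 0 = Eis (m + n) 0. Proof. by apply: eis_ext. Qed.
Lemma EisN m : - Eis m 0 = Eis (- m) 0. Proof. by apply: eis_ext. Qed.
Lemma EisX m n : Eis m 0 ^+ n = Eis (m ^+ n) 0.
Proof. by elim: n => // n IH; rewrite !exprS IH EisM. Qed.
Lemma Eis_eq0 m : (Eis m 0 == 0) = (m == 0).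
Proof. by apply/eqP/eqP => [[]|->]. Qed.

Lemma curve_emb a t : curve (emb a) (emb t) = curve a t.
Proof.
case: a t => [[a b] c] [[x y] z]; rewrite /curve /emb /=.
by rewrite !EisX !EisM !EisD Eis_eq0.
Qed.
Lemma prod3_emb t : (prod3 (emb t) == 0) = (prod3 t == 0).
Proof. by rewrite /prod3 /emb /= !EisM Eis_eq0. Qed.
Lemma sim_emb t u : sim (emb t) (emb u) = (Af t u == 0).
Proof.
case: t u => [[x y] z] [[X Y] Z]; rewrite /sim /Af /emb /=.
by rewrite !EisX !EisM EisN EisD Eis_eq0.
Qed.

Lemma cube_inj (x y : int) : x ^+ 3 = y ^+ 3 -> x = y.
Proof.
move=> E; have : (x - y) * (x ^+ 2 + x * y + y ^+ 2) = 0.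
  by transitivity (x ^+ 3 - y ^+ 3); [ring | rewrite E subrr].
move=> /eqP; rewrite mulf_eq0 => /orP[/eqP|/eqP]; first by lia.
have := sqr_ge0 (x + y); rewrite !expr2; nia.
Qed.

Definition proportional (t u : int * int * int) :=
  [&& t.1.1 * u.1.2 == t.1.2 * u.1.1, t.1.2 * u.2 == t.2 * u.1.2
    & t.2 * u.1.1 == t.1.1 * u.2].

(** If [Af] vanishes, so do all minors of the vectors of cubes, and integers with equal cubes are
    equal. *)
Lemma Af_prop (a t u : int * int * int) : a.1.1 != 0 -> curve a t -> curve a u ->
  Af t u = 0 -> proportional t u.
Proof.
move=> a0 ct cu A; have [] := curve_Af ct cu; rewrite A !mulr0 => /eqP E1 /eqP E2.
move: E1 E2; rewrite !mulf_eq0 (negbTE a0) /= !subr_eq0 => /eqP E1 /eqP E2.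
move: A; case: t u {ct cu} E1 E2 => [[x y] z] [[X Y] Z] /= E1 E2.
rewrite /Af => /eqP; rewrite subr_eq0 => /eqP E3.
by apply/and3P; split; apply/eqP/cube_inj; rewrite !exprMn.
Qed.

(** A vanishing coordinate leaves a two-term equation, which fixes the ratio of the other two
    cubes. *)
Lemma zero_Af (a t u : int * int * int) : prod3 a != 0 -> curve a t -> curve a u ->
  [\/ t.1.1 = 0 /\ u.1.1 = 0, t.1.2 = 0 /\ u.1.2 = 0 | t.2 = 0 /\ u.2 = 0] -> Af t u = 0.
Proof.
move=> a0 ct cu; have [E _] := curve_Af ct cu.
have a2 : a.2 != 0 by move: a0; rewrite /prod3 mulf_eq0 negb_or => /andP[].
case=> [[t0 u0]|[t0 u0]|[t0 u0]].
- apply: (mulfI a2); rewrite -E t0 u0; ring.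
- by case: t u t0 u0 {ct cu E} => [[x y] z] [[X Y] Z] /= -> ->; rewrite /Af; ring.
- by case: t u t0 u0 {ct cu E} => [[x y] z] [[X Y] Z] /= -> ->; rewrite /Af; ring.
Qed.

Definition primitive (t : int * int * int) := gcdz (gcdz t.1.1 t.1.2) t.2 == 1.

Lemma primitive_bezout t : primitive t ->
  exists u v w, u * t.1.1 + v * t.1.2 + w * t.2 = 1.
Proof.
move=> /eqP E; have [u [v uv]] := Bezoutz t.1.1 t.1.2.
have [p [q pq]] := Bezoutz (gcdz t.1.1 t.1.2) t.2.
by exists (p * u), (p * v), q; rewrite -E -pq -uv; ring.
Qed.

(** Bezout coefficients of t produce the factor k with u = k t, and those of u show that k is a
    unit. *)
Lemma primitive_prop t u : primitive t -> primitive u -> proportional t u ->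
  u = t \/ u = (- t.1.1, - t.1.2, - t.2).
Proof.
move=> /primitive_bezout[p [q [r E]]] /primitive_bezout[p' [q' [r' E']]].
case: t u E E' => [[x y] z] [[X Y] Z] /= E E' /and3P[/= /eqP A /eqP B /eqP C].
pose k := p * X + q * Y + r * Z.
have kX : X = k * x.
  rewrite -[LHS]mulr1 -E /k; transitivity (p * x * X + q * (y * X) + r * (z * X)); first by ring.
  by rewrite -A C; ring.
have kY : Y = k * y.
  rewrite -[LHS]mulr1 -E /k; transitivity (p * (x * Y) + q * y * Y + r * (z * Y)); first by ring.
  by rewrite A -B; ring.
have kZ : Z = k * z.
  rewrite -[LHS]mulr1 -E /k; transitivity (p * (x * Z) + q * (y * Z) + r * z * Z); first by ring.
  by rewrite -C B; ring.
have : k \is a GRing.unit.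
  apply/unitrPr; exists (p' * x + q' * y + r' * z); rewrite -E' {1}kX {1}kY {1}kZ; ring.
rewrite unfold_in /= => /orP[/eqP k1|/eqP k1]; rewrite kX kY kZ k1.
  by left; rewrite !mul1r.
by right; rewrite !mulN1r.
Qed.

Lemma norm_Eis m : norm (Eis m 0) = (`|m| ^ 2)%N.
Proof.
by rewrite -abszX /norm /normz /=; congr absz; ring.
Qed.

(** The coordinates have norm at most B^2, so each of the three factors has norm at most 2 (B^4 +
    B^4). *)
Lemma norm_Uf (w : eis) (t u : int * int * int) B : norm w = 1%N ->
  (forall i, i \in [:: t.1.1; t.1.2; t.2; u.1.1; u.1.2; u.2] -> `|i| <= B%:Z) ->
  (norm (Uf w (emb t) (emb u)) <= 64 * B ^ 12)%N.
Proof.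
move=> w1 H; have nb i : i \in [:: t.1.1; t.1.2; t.2; u.1.1; u.1.2; u.2] ->
    (norm (Eis i 0) <= B ^ 2)%N.
  by move=> /H iB; rewrite norm_Eis leq_exp2r // -lez_nat abszE.
have fac i j i' j' : i \in [:: t.1.1; t.1.2; t.2; u.1.1; u.1.2; u.2] ->
    j \in [:: t.1.1; t.1.2; t.2; u.1.1; u.1.2; u.2] ->
    i' \in [:: t.1.1; t.1.2; t.2; u.1.1; u.1.2; u.2] ->
    j' \in [:: t.1.1; t.1.2; t.2; u.1.1; u.1.2; u.2] ->
    (norm (Eis i 0 * Eis j 0 - w * (Eis i' 0 * Eis j' 0))%R <= 4 * B ^ 4)%N.
  move=> hi hj hi' hj'; apply: leq_trans (norm_leD _ _) _.
  rewrite normN !normM w1 mul1n (_ : (4 = 2 * 2)%N) // -mulnA leq_mul2l /= mul2n -addnn.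
  by rewrite (expnD B 2 2) leq_add // leq_mul // nb.
case: t u H nb fac => [[x y] z] [[X Y] Z] /= H nb fac.
rewrite /Uf /emb /= !normM (_ : (64 * B ^ 12 = 4 * B ^ 4 * (4 * B ^ 4) * (4 * B ^ 4))%N).
  by rewrite !leq_mul // fac // !inE eqxx ?orbT.
by rewrite (_ : (12 = 4 + 4 + 4)%N) // !expnD; ring.
Qed.

Lemma height_emb (a t u : int * int * int) B : prod3 a != 0 -> curve a t -> curve a u ->
    nsim (emb t) (emb u) ->
    (forall i, i \in [:: t.1.1; t.1.2; t.2; u.1.1; u.1.2; u.2] -> `|i| <= B%:Z) ->
  height_le 1 (64 * B ^ 12) (emb t) (emb u).
Proof.
move=> a0 ct cu n H.
have [u0 u1 u2] : [/\ U0 (emb t) (emb u) != 0, U1 (emb t) (emb u) != 0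
                   & U2 (emb t) (emb u) != 0].
  by apply: (@nsim_U (emb a)); rewrite ?curve_emb // prod3_emb.
have [g [v0 [v1 [v2 [g0 E0 E1 E2 [cop _]]]]]] := U_reduce u0.
have le v : (norm v <= norm (g * v)%R)%N by rewrite normM leq_pmull // norm_gt0.
exists g, v0, v1, v2; split=> //; split; rewrite // expn1; apply: leq_trans (le _) _.
- by rewrite -E0; apply: norm_Uf.
- by rewrite -E1; apply: norm_Uf.
- by rewrite -E2; apply: norm_Uf.
Qed.

Lemma goodE B a b c t : Defs.good B a b c t ->
  [/\ curve (a, b, c) t, primitive t &
      forall i, i \in [:: t.1.1; t.1.2; t.2] -> `|i| <= B%:Z].
Proof.
case: t => [[x y] z] /= /and5P[ct pt xB yB zB]; split=> // i.
by rewrite !inE => /or3P[] /eqP ->.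
Qed.

Lemma box_uniq B : uniq (box B).
Proof. by rewrite map_inj_uniq ?iota_uniq // => i j /addIr []. Qed.

Lemma prop_refl t : proportional t t.
Proof. by case: t => [[x y] z]; rewrite /proportional /= mulrC eqxx mulrC eqxx mulrC eqxx. Qed.

(** The factor 2 accounts for a primitive triple and its negative. *)
Lemma prim_transversal (s : seq (int * int * int)) : uniq s -> all primitive s ->
  exists r, [/\ {subset r <= s}, pairwise (fun t u => ~~ proportional t u) r &
                (size s <= 2 * size r)%N].
Proof.
move=> us /allP ps; apply: transversal => [t _|t ts]; first exact: prop_refl.
rewrite -size_filter.
apply: (@uniq_leq_size _ _ [:: t; (- t.1.1, - t.1.2, - t.2)]); first exact: filter_uniq.
move=> u; rewrite mem_filter => /andP[tu us'].
by case: (primitive_prop (ps t ts) (ps u us') tu) => ->; rewrite !inE eqxx ?orbT.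
Qed.

Lemma size_zero_coord (a : int * int * int) s : prod3 a != 0 ->
    (forall t, t \in s -> curve a t /\ prod3 t = 0) ->
    pairwise (fun t u => ~~ proportional t u) s -> (size s <= 3)%N.
Proof.
move=> a0 H ps; have a1 : a.1.1 != 0.
  by move: a0; rewrite /prod3 !mulf_eq0 !negb_or => /andP[/andP[]].
(* The index of the first vanishing coordinate; the default 2 is right because the product of the
   coordinates is zero. *)
pose key (t : int * int * int) : nat :=
  if t.1.1 == 0 then 0%N else if t.1.2 == 0 then 1%N else 2%N.
apply: (pairwise_keys (f := key) (k := [:: 0; 1; 2]%N) ps).
  by move=> t _; rewrite /key; case: ifP => // _; case: ifP.
move=> t u /H[ct t0] /H[cu u0] /negP ntu E; apply: ntu.
apply: (Af_prop a1 ct cu); apply: (zero_Af a0 ct cu); move: E t0 u0.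
rewrite /key /prod3.
have [tx|tx] := eqVneq t.1.1 0; have [ux|ux] := eqVneq u.1.1 0.
- by constructor 1.
- by case: ifP.
- by case: ifP.
have [ty|ty] := eqVneq t.1.2 0; have [uy|uy] := eqVneq u.1.2 0 => // _.
  by constructor 2.
move=> /eqP; rewrite !mulf_eq0 (negbTE tx) (negbTE ty) /= => /eqP tz /eqP.
by rewrite !mulf_eq0 (negbTE ux) (negbTE uy) /= => /eqP uz; constructor 3.
Qed.

(** * The bound for the counting function *)

Lemma pow_absorb M n T X : (0 < X)%N -> (n <= 2 * (3 + T))%N -> (T ^ M <= X)%N ->
  (n ^ M <= 8 ^ M * X)%N.
Proof.
move=> X0 nT TX; have [T1|T1] := leqP T 1.
  apply: (@leq_trans (8 ^ M)); last by rewrite leq_pmulr.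
  by apply: leq_expn; apply: leq_trans nT _; lia.
apply: (@leq_trans ((8 * T) ^ M)); last by rewrite expnMn leq_mul.
by apply: leq_expn; apply: leq_trans nT _; lia.
Qed.

(** With h = 64 B^12, [bound] contributes h^6 and the divisors of d contribute at most a constant
    times norm d <= h^3; thus 108 = 12 (6 + 3). *)
Lemma rho_bound k : exists C, forall a b c : int, a != 0 -> b != 0 -> c != 0 ->
  forall B, (1 <= B)%N -> (rho B a b c ^ (3 ^ k) <= C * B ^ 108)%N.
Proof.
have [C1 C10 HC] := @bound k 1 isT; rewrite mul1n in HC.
set M := (3 ^ k)%N in HC *.
(* This exponent is the one of [size L] in [bound], so that power is at most K times the norm of
   d. *)
have [K HK] := divisor_bound (3 * k * M).
exists (8 ^ M * (C1 * K * 64 ^ 9 + 1))%N => a b c a0 b0 c0 B B1.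
pose al := (a, b, c).
have al0 : prod3 al != 0 by rewrite /prod3 !mulf_neq0.
have al1 : prod3 (emb al) != 0 by rewrite prod3_emb.
pose s := filter (Defs.good B a b c)
  [seq (xy, z) | xy <- [seq (x, y) | x <- box B, y <- box B], z <- box B].
have sg t : t \in s -> Defs.good B a b c t by rewrite mem_filter => /andP[].
have us : uniq s.
  apply: filter_uniq; apply: allpairs_uniq; rewrite ?box_uniq //.
    by apply: allpairs_uniq; rewrite ?box_uniq // => -[? ?] [? ?] _ _ [-> ->].
  by move=> [[? ?] ?] [[? ?] ?] _ _ [-> -> ->].
have [||r [rs pr sz]] := @prim_transversal s => //.
  by apply/allP => t /sg/goodE[].
pose r0 := filter (fun t => prod3 t == 0) r.
pose r1 := filter (predC (fun t => prod3 t == 0)) r.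
have cr t : t \in r -> curve al t by move=> /rs/sg/goodE[].
have sz0 : (size r0 <= 3)%N.
  apply: (@size_zero_coord al) => //.
    by move=> t; rewrite mem_filter => /andP[/eqP t0 /cr].
  by apply: subseq_pairwise pr; apply: filter_subseq.
pose T := [seq emb t | t <- r1].
have szr : size r = (size r0 + size T)%N by rewrite size_map !size_filter count_predC.
have rhoE : (rho B a b c <= 2 * (3 + size T))%N.
  rewrite /rho -size_filter -/s; apply: leq_trans sz _.
  by rewrite leq_mul2l /= szr leq_add2r.
have h0 : (0 < 64 * B ^ 12)%N by rewrite muln_gt0 expn_gt0 B1.
rewrite -mulnA; apply: (pow_absorb _ rhoE).
  by rewrite muln_gt0 addn1 /= expn_gt0 B1.
have r1P t : t \in r1 -> [/\ t \in r, curve al t & prod3 t != 0].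
  by rewrite mem_filter => /andP[/= t0 tr]; split=> //; apply: cr.
have gT P : P \in T -> goodpt (emb al) P.
  by move=> /mapP[t /r1P[_ ct t0] ->]; rewrite /goodpt curve_emb ct prod3_emb.
have a1 : al.1.1 != 0 by [].
have pT : pairwise nsim T.
  rewrite pairwise_map; apply: (@sub_in_pairwise _ (mem r1) (fun t u => ~~ proportional t u)).
  - move=> t u /r1P[_ ct _] /r1P[_ cu _]; apply: contra => /=; rewrite sim_emb => /eqP.
    exact: Af_prop a1 ct cu.
  - exact/allP.
  - by apply: subseq_pairwise pr; apply: filter_subseq.
have bnd t u : t \in r1 -> u \in r1 ->
    forall i, i \in [:: t.1.1; t.1.2; t.2; u.1.1; u.1.2; u.2] -> `|i| <= B%:Z.
  move=> /r1P[/rs/sg/goodE[_ _ tB] _ _] /r1P[/rs/sg/goodE[_ _ uB] _ _] i.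
  rewrite -[X in i \in X]/([:: t.1.1; t.1.2; t.2] ++ [:: u.1.1; u.1.2; u.2]) mem_cat.
  by case/orP => [/tB|/uB].
have hT P Q : P \in T -> Q \in T -> nsim P Q -> height_le 1 (64 * B ^ 12) P Q.
  move=> /mapP[t tr ->] /mapP[u ur ->] n.
  have [_ ct _] := r1P t tr; have [_ cu _] := r1P u ur.
  by apply: (height_emb al0 ct cu n); apply: bnd.
have X1 : (1 <= (C1 * K * 64 ^ 9 + 1) * B ^ 108)%N.
  by rewrite muln_gt0 addn1 /= expn_gt0 B1.
(* The bound for d comes from two distinct points; with at most one point in T the claim is
   immediate. *)
have [T1|T2] := leqP (size T) 1.
  by apply: leq_trans X1; rewrite -(exp1n M) leq_expn.
have [d [w [dE w0 cfd]]] := cubefree_decomp al1.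
have [L sL dL] := HK d cfd.
have E : 1 ^+ 3 * prod3 (emb al) = w ^+ 3 * d by rewrite dE; ring.
have TL := HC d L (emb al) T _ 1 w cfd dL al1 (oner_neq0 _) w0 E h0 gT pT hT.
have [t [u [tr ur n]]] : exists t u, [/\ t \in r1, u \in r1 & nsim (emb t) (emb u)].
  move: pT T2; rewrite /T; case: (r1) => [|t [|u r']] //= /andP[/andP[n _] _] _.
  by exists t, u; rewrite !inE !eqxx orbT.
have nd : (norm d <= (64 * B ^ 12) ^ 3)%N.
  have [nd _] := lift_class al1 cfd (oner_neq0 _) w0 (gT _ (map_f _ tr)) (gT _ (map_f _ ur)) n E.
  have le w1 : norm w1 = 1%N -> (norm (Uf w1 (emb t) (emb u)) <= 64 * B ^ 12)%N.
    by move=> n1; apply: norm_Uf n1 (bnd t u tr ur).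
  apply: leq_trans nd _; move: (64 * B ^ 12)%N le => h le.
  by rewrite !expnS expn0 muln1 mulnA; apply: leq_mul; [apply: leq_mul|]; apply: le.
apply: leq_trans TL _.
apply: (@leq_trans (C1 * (K * (64 * B ^ 12) ^ 3) * (64 * B ^ 12) ^ 6)).
  rewrite leq_mul // leq_mul //; apply: leq_trans sL _.
  by rewrite leq_mul.
have aux (x y : nat) : (C1 * (K * (x * y) ^ 3) * (x * y) ^ 6 = C1 * K * x ^ 9 * y ^ 9)%N.
  by ring.
by rewrite aux -expnM mulnDl leq_addr.
Qed.

(* MathComp has taken over the key %R. *)
Delimit Scope R_scope with real.

(** * Passage to real exponents *)

Lemma INR_expn m n : INR (m ^ n)%N = (INR m ^ n)%real.
Proof. by elim: n => // n IH; rewrite expnS mult_INR IH. Qed.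

Lemma pow_le_inv (x y : R) n :
  (0 < y)%real -> (x ^ n.+1 <= y ^ n.+1)%real -> (x <= y)%real.
Proof.
move=> y0 H; apply: Rnot_lt_le => yx.
have yn : (y ^ n <= x ^ n)%real by apply: pow_incr; lra.
have y1 : (0 < y ^ n)%real by exact: pow_lt.
have := Rmult_le_compat_l x _ _ _ yn; have := Rmult_lt_compat_r _ _ _ y1 yx.
by move: H => /=; lra.
Qed.

Theorem theorem3 :
  forall eps : R, Rlt R0 eps ->
  exists C : R,
    forall a b c : int, a != 0%R -> b != 0%R -> c != 0%R ->
    forall B : nat, (1 <= B)%N ->
      Rle (INR (rho B a b c)) (Rmult C (Rpower (INR B) eps)).
Proof.
move=> eps eps0.
(* Since k <= 3^k, this gives 108 / 3^k <= eps, so the 3^k-th root of B^108 is at most B^eps. *)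
have [k Hk] := INR_unbounded (108 / eps)%real.
have [C HC] := rho_bound k.
(* Adding 1 makes the constant at least 1, so that its positive powers dominate [INR C]. *)
exists (INR C + 1)%real => a b c a0 b0 c0 B B1.
have {HC} := HC a b c a0 b0 c0 B B1; move: (rho B a b c) => n.
have : (0 < 3 ^ k)%N by rewrite expn_gt0.
have : (INR k <= INR (3 ^ k))%real by apply: le_INR; apply/ssrnat.leP; apply: ltnW; apply: ltn_expl.
case: (3 ^ k)%N => // M kM _ /ssrnat.leP/le_INR; rewrite mult_INR !INR_expn => H.
have B1' : (1 <= INR B)%real by rewrite -[1%real]/(INR 1); apply: le_INR; apply/ssrnat.leP.
have epsM : (108 <= eps * INR M.+1)%real.
  have : (108 / eps * eps <= INR M.+1 * eps)%real by apply: Rmult_le_compat_r; lra.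
  by rewrite /Rdiv Rmult_assoc Rinv_l; lra.
have C0 : (0 <= INR C)%real by exact: pos_INR.
have P0 : (0 < Rpower (INR B) eps)%real by exact: exp_pos.
apply: (@pow_le_inv _ _ M); first by apply: Rmult_lt_0_compat; lra.
apply: Rle_trans H _; rewrite Rpow_mult_distr.
apply: Rmult_le_compat; [lra | by apply: pow_le; lra | |].
  have : (1 <= (INR C + 1) ^ M)%real by apply: pow_R1_Rle; lra.
  by rewrite /=; move: ((INR C + 1) ^ M)%real => t t1; nra.
rewrite -!Rpower_pow ?Rpower_mult; [|by []|lra].
by apply: Rle_Rpower => //; apply: Rle_trans epsM; rewrite INR_IZR_INZ; apply: Req_le.
Qed.
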